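(* Let $(E,\langle\cdot,\cdot\rangle,\pi,[\cdot,\cdot])$ be an odd exact Courant algebroid over an $n$-dimensional manifold $M$ and let $\mathcal F$ be a $B_n$-generalized almost complex structure on $E$. Then $\mathcal F$ is integrable if and only if there is a torsion-free generalized connection $D$ on $E$ which preserves $\mathcal F$, i.e. such that $T^D=0$ and $D\mathcal F=0$.
   Context: A Courant algebroid over a smooth manifold $M$ is a real vector bundle $E\to M$ with a non-degenerate symmetric bilinear form $\langle\cdot,\cdot\rangle$ (scalar product), a bundle map $\pi:E\to TM$ (anchor) and an $\mathbb R$-bilinear bracket $[\cdot,\cdot]$ on $\Gamma(E)$ (Dorfman bracket) such that for all $u,v,w\in\Gamma(E)$, $f\in C^\infty(M)$: $[u,[v,w]]=[[u,v],w]+[v,[u,w]]$; $[u,fv]=f[u,v]+\pi(u)(f)v$; $\pi(u)\langle v,w\rangle=\langle[u,v],w\rangle+\langle v,[u,w]\rangle$; $\langle[u,v]+[v,u],w\rangle=\pi(w)\langle u,v\rangle$. With $n=\dim M$, it is odd exact (of type $B_n$) if $\pi$ is surjective and $\langle\cdot,\cdot\rangle$ has signature $(n+1,n)$ (so $\mathrm{rank}\,E=2n+1$). The bracket, anchor and scalar product are extended complex-linearly to $E^{\mathbb C}=E\otimes\mathbb C$. A generalized connection on $E$ is an $\mathbb R$-linear map $D:\Gamma(E)\to\Gamma(E^*\otimes E)$, $u\mapsto Du$, with $D_v(fu)=\pi(v)(f)u+fD_vu$ and $\pi(w)\langle u,v\rangle=\langle D_wu,v\rangle+\langle u,D_wv\rangle$.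 Its torsion $T^D\in\Gamma(\Lambda^3E^* )$ is $T^D(u,v,w)=\langle D_uv-D_vu-[u,v],w\rangle+\langle D_wu,v\rangle$; $D$ is torsion-free if $T^D=0$. $D$ is extended to tensors as usual, e.g. $(D_u\mathcal F)v=D_u(\mathcal Fv)-\mathcal F(D_uv)$. A $B_n$-generalized almost complex structure on $E$ is a $\langle\cdot,\cdot\rangle$-skew-symmetric endomorphism $\mathcal F\in\Gamma(\mathrm{End}\,E)$ of rank $2n$ with $\mathcal F^2=-\mathrm{Id}+(-1)^n\langle\cdot,u_0\rangle u_0$ for a section $u_0\in\Gamma(E)$ with $\langle u_0,u_0\rangle=(-1)^n$ ($u_0$ is unique up to sign and spans $\mathrm{Ker}\,\mathcal F$). Let $L\subset E^{\mathbb C}$ be the $i$-eigenbundle of $\mathcal F$ (an isotropic rank $n$ subbundle with $L\cap\bar L=0$; giving $L$ is equivalent to giving $\mathcal F$). $\mathcal F$ is integrable if $\Gamma(L)$ is closed under the Dorfman bracket. *)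

(* Defs.v *)
(* MathComp / MathComp-Analysis. *)
From HB Require Import structures.
From mathcomp Require Import all_boot all_order all_algebra.
From mathcomp Require Import all_classical all_reals all_analysis.

Set Implicit Arguments.
Unset Strict Implicit.
Unset Printing Implicit Defensive.

Import Order.TTheory GRing.Theory Num.Theory.
Import numFieldTopology.Exports numFieldNormedType.Exports.

Local Open Scope classical_set_scope.
Local Open Scope ring_scope.

(* Smoothness of real functions on an open subset U of R^n: all iterated
   partial derivatives exist and are continuous on U.  The predicates are only
   meant for open U; values of f outside U are then irrelevant. *)
Section euclidean.
Context {R : realType} {n : nat}.
Implicit Types (U : set 'rV[R]_n) (f : 'rV[R]_n -> R).

Fixpoint Ck (k : nat) U f : Prop :=
  {in U, continuous f} /\
  if k is k'.+1 then
    forall i : 'I_n, {in U, forall x, derivable f x (delta_mx 0 i)} /\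
                     Ck k' U (fun x => derive f x (delta_mx 0 i))
  else True.

Definition Cinf U f : Prop := forall k, Ck k U f.

End euclidean.

(* A chart is a homeomorphism from an open set of T onto an open set of R^n;
   both maps are total functions whose values outside chart_dom, resp. outside
   the image of chart_dom, are irrelevant. *)
Record chart (R : realType) (n : nat) (T : topologicalType) := Chart {
  chart_dom : set T;
  chart_map :> T -> 'rV[R]_n;
  chart_inv : 'rV[R]_n -> T;
  chart_dom_open : open chart_dom;
  chart_img_open : open (chart_map @` chart_dom);
  chart_mapK : {in chart_dom, cancel chart_map chart_inv};
  chart_map_continuous : {in chart_dom, continuous chart_map};
  chart_inv_continuous : {in chart_map @` chart_dom, continuous chart_inv}
}.

(* The atlas need not be maximal. *)
Record smooth_manifold (R : realType) (n : nat) := SmoothManifold {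
  carrier :> topologicalType;
  carrier_hausdorff : hausdorff_space carrier;
  carrier_second_countable : @second_countable carrier;
  atlas : set (chart R n carrier);
  atlas_cover : forall x : carrier, exists2 phi, atlas phi & chart_dom phi x;
  atlas_compat : forall phi psi, atlas phi -> atlas psi -> forall i : 'I_n,
    Cinf (phi @` (chart_dom phi `&` chart_dom psi))
         (fun y => psi (chart_inv phi y) 0 i)
}.

Section manifold.
Context {R : realType} {n : nat} {M : smooth_manifold R n}.

(* For open U. *)
Definition smooth_on (U : set M) (f : M -> R) : Prop :=
  forall phi, atlas phi ->
    Cinf (phi @` (chart_dom phi `&` U)) (f \o chart_inv phi).

Definition smooth (f : M -> R) : Prop := smooth_on setT f.

End manifold.

(* Tangent vectors at x are the derivations of C^oo(M) at x.  Only the values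
   on smooth functions matter, so v, w : tangent x denote the same tangent
   vector when v f = w f for every smooth f. *)
Record tangent (R : realType) (n : nat) (M : smooth_manifold R n) (x : M) :=
  Tangent {
  derivation :> (M -> R) -> R;
  derivation_linear : forall (a : R) f g, smooth f -> smooth g ->
    derivation (fun y => a * f y + g y) = a * derivation f + derivation g;
  derivation_leibniz : forall f g, smooth f -> smooth g ->
    derivation (fun y => f y * g y) = derivation f * g x + f x * derivation g
}.

Record local_frame (R : realType) (n : nat) (M : smooth_manifold R n)
    (V : M -> vectType R) (r : nat) := LocalFrame {
  frame_dom : set M;
  frame_vec :> forall x, r.-tuple (V x);
  frame_dom_open : open frame_dom;
  frame_basis : forall x, frame_dom x -> basis_of fullv (frame_vec x)
}.

(* A smooth real vector bundle of rank r, presented by its fibres and by a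
   family of local frames (equivalently, local trivializations) that cover M
   and whose transition matrices are smooth. *)
Record vbundle (R : realType) (n : nat) (M : smooth_manifold R n) (r : nat) :=
  VBundle {
  fiber :> M -> vectType R;
  frames : set (local_frame fiber r);
  frames_cover : forall x, exists2 e, frames e & frame_dom e x;
  frames_compat : forall e e', frames e -> frames e' -> forall i j : 'I_r,
    smooth_on (frame_dom e `&` frame_dom e')
              (fun x => coord (e' x) i (tnth (e x) j))
}.

(* Set-theoretic sections; smoothness is a separate predicate. *)
Definition section (R : realType) (n : nat) (M : smooth_manifold R n) (r : nat)
  (E : vbundle M r) : Type := forall x : M, E x.

(* Pointwise real vector space structure on sections. *)
Section section_lmod.
Context {R : realType} {n : nat} {M : smooth_manifold R n} {r : nat}.
Variable E : vbundle M r.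

HB.instance Definition _ := gen_eqMixin (section E).
HB.instance Definition _ := gen_choiceMixin (section E).

Definition sec0 : section E := fun x => 0.
Definition secD (u v : section E) : section E := fun x => u x + v x.
Definition secN (u : section E) : section E := fun x => - u x.
Definition secZ (a : R) (u : section E) : section E := fun x => a *: u x.

Let secDA : associative secD.
Proof. by move=> u v w; apply: functional_extensionality_dep => x; exact: addrA. Qed.
Let secDC : commutative secD.
Proof. by move=> u v; apply: functional_extensionality_dep => x; exact: addrC. Qed.
Let sec0D : left_id sec0 secD.
Proof. by move=> u; apply: functional_extensionality_dep => x; exact: add0r. Qed.
Let secND : left_inverse sec0 secN secD.
Proof. by move=> u; apply: functional_extensionality_dep => x; exact: addNr. Qed.

HB.instance Definition _ :=
  GRing.isZmodule.Build (section E) secDA secDC sec0D secND.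

Let secZA a b u : secZ a (secZ b u) = secZ (a * b) u.
Proof. by apply: functional_extensionality_dep => x; exact: scalerA. Qed.
Let sec1Z : left_id 1 secZ.
Proof. by move=> u; apply: functional_extensionality_dep => x; exact: scale1r. Qed.
Let secZDr : right_distributive secZ +%R.
Proof. by move=> a u v; apply: functional_extensionality_dep => x; exact: scalerDr. Qed.
Let secZDl u : {morph secZ^~ u : a b / a + b}.
Proof. by move=> a b; apply: functional_extensionality_dep => x; exact: scalerDl. Qed.

HB.instance Definition _ :=
  GRing.Zmodule_isLmodule.Build R (section E) secZA sec1Z secZDr secZDl.

End section_lmod.

Section sections.
Context {R : realType} {n : nat} {M : smooth_manifold R n} {r : nat}.
Context {E : vbundle M r}.

Definition fmul (f : M -> R) (u : section E) : section E := fun x => f x *: u x.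

Definition smooth_section_on (U : set M) (u : section E) : Prop :=
  forall e, frames e -> forall i : 'I_r,
    smooth_on (U `&` frame_dom e) (fun x => coord (e x) i (u x)).

Definition smooth_section (u : section E) : Prop := smooth_section_on setT u.

(* Set-theoretic sections of End E = E^* (x) E, acting on sections of E. *)
Definition endo : Type := forall x : M, 'End(E x).

Definition eapp (A : endo) (u : section E) : section E := fun x => A x (u x).

Definition smooth_endo (A : endo) : Prop :=
  forall e, frames e -> forall j : 'I_r,
    smooth_section_on (frame_dom e) (fun x => A x (tnth (e x) j)).

End sections.

Arguments endo {R n M r} E.

Record courant_data (R : realType) (n : nat) (M : smooth_manifold R n)
    (r : nat) := CourantData {
  cbundle :> vbundle M r;
  scalar_prod : forall x : M, cbundle x -> cbundle x -> R;
  anchor : forall x : M, cbundle x -> tangent x;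
  bracket : section cbundle -> section cbundle -> section cbundle
}.

Definition pairing (R : realType) (n : nat) (M : smooth_manifold R n) (r : nat)
  (E : courant_data M r) (u v : section E) : M -> R :=
  fun x => scalar_prod (u x) (v x).

(* anchor_act u f = pi(u)(f) *)
Definition anchor_act (R : realType) (n : nat) (M : smooth_manifold R n)
  (r : nat) (E : courant_data M r) (u : section E) (f : M -> R) : M -> R :=
  fun x => anchor (u x) f.

(* The bracket is an operation on smooth sections: it preserves smoothness and
   all axioms are required for smooth sections only, its values on other
   set-theoretic sections being irrelevant. *)
Record is_courant (R : realType) (n : nat) (M : smooth_manifold R n) (r : nat)
    (E : courant_data M r) : Prop := IsCourant {
  scalar_linear : forall (x : M) (a : R) (u v w : E x),
    scalar_prod (a *: u + v) w = a * scalar_prod u w + scalar_prod v w;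
  scalar_sym : forall (x : M) (u v : E x), scalar_prod u v = scalar_prod v u;
  scalar_nondegenerate : forall (x : M) (u : E x),
    (forall v, scalar_prod u v = 0) -> u = 0;
  scalar_smooth : forall e, frames (v := E) e -> forall i j : 'I_r,
    smooth_on (frame_dom e) (fun x => scalar_prod (tnth (e x) i) (tnth (e x) j));
  anchor_linear : forall (x : M) (a : R) (u v : E x) (f : M -> R), smooth f ->
    anchor (a *: u + v) f = a * anchor u f + anchor v f;
  (* a vector field X is smooth iff X(f) is smooth for every f in C^oo(M) *)
  anchor_smooth : forall e, frames (v := E) e ->
    forall (j : 'I_r) (f : M -> R), smooth f ->
    smooth_on (frame_dom e) (fun x => anchor (tnth (e x) j) f);
  bracket_smooth : forall u v : section E,
    smooth_section u -> smooth_section v -> smooth_section (bracket u v);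
  bracket_linearl : forall (a : R) (u v w : section E),
    smooth_section u -> smooth_section v -> smooth_section w ->
    bracket (a *: u + v) w = a *: bracket u w + bracket v w;
  bracket_linearr : forall (a : R) (u v w : section E),
    smooth_section u -> smooth_section v -> smooth_section w ->
    bracket u (a *: v + w) = a *: bracket u v + bracket u w;
  bracket_jacobi : forall u v w : section E,
    smooth_section u -> smooth_section v -> smooth_section w ->
    bracket u (bracket v w) = bracket (bracket u v) w + bracket v (bracket u w);
  bracket_leibniz : forall (f : M -> R) (u v : section E),
    smooth f -> smooth_section u -> smooth_section v ->
    bracket u (fmul f v) = fmul f (bracket u v) + fmul (anchor_act u f) v;
  bracket_metric : forall u v w : section E,
    smooth_section u -> smooth_section v -> smooth_section w -> forall x,
    anchor_act u (pairing v w) x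
      = pairing (bracket u v) w x + pairing v (bracket u w) x;
  bracket_symmetrized : forall u v w : section E,
    smooth_section u -> smooth_section v -> smooth_section w -> forall x,
    pairing (bracket u v + bracket v u) w x = anchor_act w (pairing u v) x
}.

Record courant_algebroid (R : realType) (n : nat) (M : smooth_manifold R n)
    (r : nat) := CourantAlgebroid {
  courant_data_of :> courant_data M r;
  courantP : is_courant courant_data_of
}.

Definition has_signature (R : realType) (V : vectType R) (b : V -> V -> R)
    (p q : nat) : Prop :=
  exists2 e : (p + q).-tuple V, basis_of fullv e &
    forall i j : 'I_(p + q), b (tnth e i) (tnth e j) =
      if i != j then 0 else if (i < p)%N then 1 else - 1.

Section odd_exact.
Context {R : realType} {n : nat} {M : smooth_manifold R n} {r : nat}.
Variable E : courant_algebroid M r.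

Definition anchor_surjective : Prop :=
  forall (x : M) (t : tangent x), exists u : E x,
    forall f, smooth f -> anchor u f = t f.

Definition odd_exact : Prop :=
  anchor_surjective /\ forall x : M, has_signature (@scalar_prod R n M r E x) n.+1 n.

(* conn u is the endomorphism-valued section D u, and conn_at D v u is D_v u. *)
Record gen_connection := GenConnection {
  conn :> section E -> endo E;
  conn_smooth : forall u, smooth_section u -> smooth_endo (conn u);
  conn_linear : forall (a : R) u v, smooth_section u -> smooth_section v ->
    forall x, conn (a *: u + v) x = a *: conn u x + conn v x;
  conn_leibniz : forall (f : M -> R) u v,
    smooth f -> smooth_section u -> smooth_section v ->
    eapp (conn (fmul f u)) v = fmul (anchor_act v f) u + fmul f (eapp (conn u) v);
  conn_metric : forall u v w,
    smooth_section u -> smooth_section v -> smooth_section w -> forall x,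
    anchor_act w (pairing u v) x
      = pairing (eapp (conn u) w) v x + pairing u (eapp (conn v) w) x
}.

Definition conn_at (D : gen_connection) (v u : section E) : section E :=
  eapp (D u) v.

Definition torsion (D : gen_connection) (u v w : section E) : M -> R :=
  fun x => pairing (conn_at D u v - conn_at D v u - bracket u v) w x
           + pairing (conn_at D w u) v x.

Definition torsion_free (D : gen_connection) : Prop :=
  forall u v w, smooth_section u -> smooth_section v -> smooth_section w ->
  forall x, torsion D u v w x = 0.

(* conn_endo D u A v = (D_u A) v *)
Definition conn_endo (D : gen_connection) (u : section E) (A : endo E)
    (v : section E) : section E :=
  conn_at D u (eapp A v) - eapp A (conn_at D u v).

Definition preserves (D : gen_connection) (A : endo E) : Prop :=
  forall u v, smooth_section u -> smooth_section v -> conn_endo D u A v = 0.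

Record Bn_gacs (F : endo E) : Prop := BnGacs {
  gacs_smooth : smooth_endo F;
  gacs_skew : forall (x : M) (a b : E x),
    scalar_prod (F x a) b = - scalar_prod a (F x b);
  gacs_rank : forall x : M, \dim (limg (F x)) = (2 * n)%N;
  gacs_square : exists u0 : section E, [/\ smooth_section u0,
    forall x, pairing u0 u0 x = (-1) ^+ n &
    forall (x : M) (a : E x),
      F x (F x a) = - a + ((-1) ^+ n * scalar_prod a (u0 x)) *: u0 x]
}.

(* The complexification V (x) C of a real vector space V is represented by
   V * V, with (a, b) standing for a + i b; likewise a section of E (x) C is a
   pair of sections of E. *)
Definition mul_i (V : zmodType) (z : V * V) : V * V := (- z.2, z.1).

Definition csection : Type := (section E * section E)%type.

Definition smooth_csection (z : csection) : Prop :=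
  smooth_section z.1 /\ smooth_section z.2.

Definition cbracket (z w : csection) : csection :=
  (bracket z.1 w.1 - bracket z.2 w.2, bracket z.1 w.2 + bracket z.2 w.1).

(* The fibre at x of the i-eigenbundle L of F, inside E x (x) C. *)
Definition eigen_i (F : endo E) (x : M) : set (E x * E x) :=
  [set z | (F x z.1, F x z.2) = mul_i z].

Definition section_of_L (F : endo E) (z : csection) : Prop :=
  smooth_csection z /\ forall x, eigen_i F (z.1 x, z.2 x).

Definition gacs_integrable (F : endo E) : Prop :=
  forall z w, section_of_L F z -> section_of_L F w ->
    section_of_L F (cbracket z w).

End odd_exact.

(* Main.v *)
From HB Require Import structures.
Require Import Defs.
From mathcomp Require Import all_boot all_order all_algebra.
From mathcomp Require Import all_classical all_reals all_analysis.
From mathcomp Require Import ring lra.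

Set Implicit Arguments.
Unset Strict Implicit.
Unset Printing Implicit Defensive.

Import Order.TTheory GRing.Theory Num.Theory.
Import numFieldTopology.Exports numFieldNormedType.Exports.

Local Open Scope classical_set_scope.
Local Open Scope ring_scope.

(* The only obstruction to integrability is a part of the torsion.  Write W for
   the orthogonal complement of u0.  Sections of L are the a - i F a with a in
   Gamma(W), and for a metric connection D with D F = 0 closure of Gamma(L) under
   the bracket means that T = T^D satisfies
     T(Fa,Fb,Fc) = T(a,b,Fc) + T(a,Fb,c) + T(Fa,b,c)   for a, b in W and all c,
   which holds trivially when T = 0.  Conversely, with Q = -F^2 the orthogonal
   projection onto W and eps = <u0,u0>, the identity makes
     A(u,v,w) = - (T(Qu,Qv,Qw) + T(Qu,Fv,Fw)) / 4 - eps <u,u0> T(u0,Qv,Qw)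
   an F-invariant tensor, skew in v and w, with cyclic sum -T, so that D + A is
   torsion-free and still preserves F.

   A connection D with D F = 0 to start from is obtained without gluing: if
   sections p_k, locally finitely many nonzero, and signs s_k satisfy
   u = sum_k s_k <u,p_k> p_k for all u, then
   D_v u = sum_k s_k pi(v)(<u,p_k>) p_k is a metric connection.  Such families
   come from local frames, their dual frames and cutoffs; replacing each p_k by
   F p_k and F^2 p_k and adding u0 makes the family, hence D, F-invariant. *)

Local Notation sp := (@scalar_prod _ _ _ _ _ _).

(** * Differential calculus of smooth functions *)

Lemma near_eq_continuous (S T : topologicalType) (f g : S -> T) (x : S) :
  (\near x, f x = g x) -> {for x, continuous f} -> {for x, continuous g}.
Proof.
move=> fg cf; have fgx := nbhs_singleton fg.
by rewrite /prop_for /continuous_at -fgx; apply: cvg_trans cf; exact: near_eq_cvg.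
Qed.

Lemma open_near_eq (S : topologicalType) (T : Type) (U : set S) (f g : S -> T) :
  open U -> (forall x, U x -> f x = g x) -> forall x, U x -> \near x, f x = g x.
Proof.
move=> oU fg x Ux; near=> y; apply: fg; near: y; exact: open_nbhs_nbhs.
Unshelve. all: by end_near.
Qed.

Section Ck_calculus.
Context {R : realType} {n : nat}.
Implicit Types (U V : set 'rV[R]_n) (f g : 'rV[R]_n -> R).

Lemma Ck_continuous k U f : Ck k U f -> forall x, U x -> {for x, continuous f}.
Proof.
by case: k => [|k] [cf _] x Ux; apply: cf; rewrite inE.
Qed.

Lemma CkS_derive k U f : Ck k.+1 U f -> forall i : 'I_n, exists2 df,
  (forall x, U x -> is_derive x (delta_mx 0 i) f (df x)) & Ck k U df.
Proof.
move=> [_ df] i; have [fd Cf] := df i.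
exists (fun x => derive f x (delta_mx 0 i)) => // x Ux.
by apply: derivableP; apply: fd; rewrite inE.
Qed.

(** Since [U] is open, agreement on [U] is agreement near each of its points. Hence the partial
    derivatives agree on [U] too, and the induction applies to them. *)
Lemma Ck_eq k U f g : open U -> (forall x, U x -> f x = g x) -> Ck k U f -> Ck k U g.
Proof.
move=> oU; elim: k f g => [|k IH] f g fg.
  move=> [cf _]; split=> // x; rewrite inE => Ux.
  apply: (near_eq_continuous (f := f)); first exact: open_near_eq Ux.
  by apply: cf; rewrite inE.
move=> [cf df]; split.
  move=> x; rewrite inE => Ux.
  apply: (near_eq_continuous (f := f)); first exact: open_near_eq Ux.
  by apply: cf; rewrite inE.
have nfg x : U x -> \near x, f x = g x by exact: open_near_eq.
move=> i; have [fd Cf] := df i; split.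
  move=> x; rewrite inE => Ux; apply: (near_eq_derivable (f := f)); first exact: nfg.
  by apply: fd; rewrite inE.
apply: IH Cf => x Ux; apply: near_eq_derive; exact: nfg.
Qed.

(** Replaces the canonical [derive] in [Ck] by any explicit formula for the partial derivatives. The
    closure properties below supply such formulas. *)
Lemma Ck_of_derive k U f : open U -> (forall x, U x -> {for x, continuous f}) ->
  (forall i : 'I_n, exists2 df,
    (forall x, U x -> is_derive x (delta_mx 0 i) f (df x)) & Ck k U df) ->
  Ck k.+1 U f.
Proof.
move=> oU cf df; split; first by move=> x; rewrite inE => Ux; exact: cf.
move=> i; have [g gd Cg] := df i; split.
  by move=> x; rewrite inE => Ux; have [] := gd x Ux.
by apply: Ck_eq Cg => // x Ux; have [] := gd x Ux.
Qed.

Lemma CkS k U f : Ck k.+1 U f -> Ck k U f.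
Proof.
elim: k f => [|k IH] f [cf df]; first by [].
split=> // i; have [fd Cf] := df i; split=> //; exact: IH.
Qed.

Lemma Ck_subset k U V f : V `<=` U -> Ck k U f -> Ck k V f.
Proof.
move=> VU; elim: k f => [|k IH] f.
  by move=> [cf _]; split=> // x; rewrite inE => /VU Ux; apply: cf; rewrite inE.
move=> [cf df]; split; first by move=> x; rewrite inE => /VU Ux; apply: cf; rewrite inE.
move=> i; have [fd Cf] := df i; split; last exact: IH.
by move=> x; rewrite inE => /VU Ux; apply: fd; rewrite inE.
Qed.

Lemma Ck_local k U f :
  (forall x, U x -> exists V, [/\ open V, V x & Ck k V f]) -> Ck k U f.
Proof.
elim: k f => [|k IH] f H.
  split=> // x; rewrite inE => /H [V [oV Vx [cf _]]]; apply: cf; by rewrite inE.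
split; first by move=> x; rewrite inE => /H [V [oV Vx [cf _]]]; apply: cf; rewrite inE.
move=> i; split.
  move=> x; rewrite inE => /H [V [oV Vx [cf df]]].
  by have [fd _] := df i; apply: fd; rewrite inE.
apply: IH => x /H [V [oV Vx [cf df]]]; exists V; split=> //.
by have [] := df i.
Qed.

Lemma Ck_cst k U (c : R) : open U -> Ck k U (fun=> c).
Proof.
move=> oU; elim: k c => [|k IH] c.
  by split=> // x _; exact: cst_continuous.
apply: Ck_of_derive => //; first by move=> x _; exact: cst_continuous.
by move=> i; exists (fun=> 0) => // x Ux; exact: is_derive_cst.
Qed.

Lemma CkD k U f g : open U -> Ck k U f -> Ck k U g -> Ck k U (fun x => f x + g x).
Proof.
move=> oU; elim: k f g => [|k IH] f g Cf Cg.
  split=> // x; rewrite inE => Ux; apply: continuousD; [exact: (Ck_continuous Cf Ux)|exact: (Ck_continuous Cg Ux)].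
apply: Ck_of_derive => //.
  by move=> x Ux; apply: continuousD; [exact: (Ck_continuous Cf Ux)|exact: (Ck_continuous Cg Ux)].
move=> i; have [df fd Cdf] := CkS_derive Cf i; have [dg gd Cdg] := CkS_derive Cg i.
exists (fun x => df x + dg x); last exact: IH.
by move=> x Ux; apply: is_deriveD; [exact: fd|exact: gd].
Qed.

Lemma CkM k U f g : open U -> Ck k U f -> Ck k U g -> Ck k U (fun x => f x * g x).
Proof.
move=> oU; elim: k f g => [|k IH] f g Cf Cg.
  split=> // x; rewrite inE => Ux; apply: continuousM; [exact: (Ck_continuous Cf Ux)|exact: (Ck_continuous Cg Ux)].
apply: Ck_of_derive => //.
  by move=> x Ux; apply: continuousM; [exact: (Ck_continuous Cf Ux)|exact: (Ck_continuous Cg Ux)].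
move=> i; have [df fd Cdf] := CkS_derive Cf i; have [dg gd Cdg] := CkS_derive Cg i.
exists (fun x => f x * dg x + g x * df x).
  by move=> x Ux; apply: is_deriveM; [exact: fd|exact: gd].
by apply: CkD => //; apply: IH => //; exact: CkS.
Qed.

Lemma CkV k U f : open U -> (forall x, U x -> f x != 0) -> Ck k U f ->
  Ck k U (fun x => (f x)^-1).
Proof.
move=> oU f0; elim: k f f0 => [|k IH] f f0 Cf.
  split=> // x; rewrite inE => Ux; apply: continuousV => /=; [exact: f0|exact: (Ck_continuous Cf Ux)].
apply: Ck_of_derive => //.
  by move=> x Ux; apply: continuousV => /=; [exact: f0|exact: (Ck_continuous Cf Ux)].
move=> i; have [df fd Cdf] := CkS_derive Cf i.
(* The derivative -f'/f^2 is split into factors to which the induction hypothesis for 1/f and [CkM]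
   apply. *)
exists (fun x => (-1) * (((f x)^-1 * (f x)^-1) * df x)).
  move=> x Ux; have [fdx fE] := fd x Ux; apply: DeriveDef.
    by apply: derivableV => //; exact: f0.
  by rewrite deriveV ?fE ?f0 // /GRing.scale /= expr2 invfM mulN1r mulNr.
apply: CkM => //; first exact: Ck_cst.
by apply: CkM => //; apply: CkM => //; apply: IH => //; exact: CkS.
Qed.

Lemma Ck_sum k U (I : Type) (s : seq I) (P : pred I) (f : I -> 'rV[R]_n -> R) : open U ->
  (forall i, P i -> Ck k U (f i)) -> Ck k U (fun x => \sum_(i <- s | P i) f i x).
Proof.
move=> oU Cf; elim: s => [|i s IH].
  by apply: Ck_eq (Ck_cst k 0 oU) => // x _; rewrite big_nil.
case: (boolP (P i)) => Pi.
  by apply: Ck_eq (CkD oU (Cf i Pi) IH) => // x _; rewrite big_cons Pi.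
by apply: Ck_eq IH => // x _; rewrite big_cons (negbTE Pi).
Qed.

(** Restriction to the line t -> x + t v reduces the directional chain rule to the one-variable
    one. *)
Lemma is_derive_comp1 (h : R -> R) f (x v : 'rV[R]_n) (a b : R) :
  is_derive (f x) 1 h a -> is_derive x v f b -> is_derive x v (h \o f) (a * b).
Proof.
move=> [hd hE] [fd fE].
pose F (t : R) := f (t *: v + x).
have F0 : F 0 = f x by rewrite /F scale0r add0r.
have dE (g : 'rV[R]_n -> R) : derive g x v = derive (fun t : R => g (t *: v + x)) 0 1.
  rewrite /derive; set g1 := fun h => h^-1 *: _; set g2 := fun h => h^-1 *: _.
  suff -> : g1 = g2 by [].
  by rewrite funeqE /g1 /g2 => t /=; rewrite addr0 scale0r add0r [_%:A]mulr1.
have Fd : is_derive (0 : R) (1 : R) F b.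
  by apply: DeriveDef; [exact: ((derivable1P f x v).1 fd)|rewrite -fE dE].
have hd' : is_derive (F 0) (1 : R) h a by rewrite F0; exact: DeriveDef.
have [D1 D2] := is_derive1_comp hd' Fd.
by apply: DeriveDef; [exact: ((derivable1P _ x v).2 D1)|rewrite dE].
Qed.

End Ck_calculus.

(** * Functions of one variable that are flat at 0 *)

Section flat_functions.
Context {R : realType}.
Implicit Types (p : {poly R}).

(** The polynomial parameter closes the family under differentiation; p = 1 gives the classical
    exp(-1/t), extended by 0. *)
Definition flat p (t : R) : R := if 0 < t then p.[t^-1] * expR (- t^-1) else 0.

(** The exponential series gives y^i <= i! exp(y) for y >= 0; the bounds are summed over the
    coefficients of p. *)
Lemma horner_expR_bounded p : exists2 C : R, 0 <= C &
  forall y, 0 <= y -> `|p.[y] * expR (- y)| <= C.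
Proof.
have mono i : forall y : R, 0 <= y -> y ^+ i * expR (- y) <= i`!%:R.
  move=> y y0; rewrite expRN ler_pdivrMr ?expR_gt0 //.
  case: i => [|i].
    by rewrite expr0 fact0 mul1r; apply: le_trans (expR_ge1Dx y); rewrite lerDl.
  have /(le_trans _) := expR_ge1Dxn i y0.
  rewrite -ler_pdivrMl ?ltr0n ?fact_gt0 // mulrC; apply.
  by rewrite lerDr.
exists (\sum_(i < size p) `|p`_i| * i`!%:R).
  by apply: sumr_ge0 => i _; apply: mulr_ge0.
move=> y y0; rewrite horner_coef mulr_suml; apply: le_trans (ler_norm_sum _ _ _) _.
apply: ler_sum => i _; rewrite -mulrA normrM ler_wpM2l //.
by rewrite ger0_norm ?mono // mulr_ge0 ?exprn_ge0 // expR_ge0.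
Qed.

Lemma is_derive_horner p (y : R) : is_derive y (1 : R) (horner p) p^`().[y].
Proof.
by apply: DeriveDef; [exact: derivable_horner|rewrite derivE derive1E].
Qed.

(** For t > 0 put y = 1/t, so that dy/dt = - y^2; differentiating p(y) exp(-y) produces the factor
    (p - p') X^2. Only t = 0 needs an estimate. *)
Lemma is_derive_flat p (t : R) :
  is_derive t (1 : R) (flat p) (flat ((p - p^`()) * 'X^2) t).
Proof.
have [t0|t0|<-] := ltgtP 0 t.
- have Vd : is_derive t (1 : R) (fun y : R => y^-1) (- t ^- 2).
    have t0' : t != 0 by rewrite gt_eqF.
    apply: DeriveDef; first exact: (@derivableV _ _ id).
    by rewrite (@deriveV _ _ id) // derive_id /GRing.scale /= mulr1.
  have H1 := is_derive1_comp (is_derive_horner p t^-1) Vd.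
  have Nd : is_derive t (1 : R) (fun y : R => - y^-1) (t ^- 2).
    by have := is_deriveN Vd; rewrite opprK.
  have H2 := @is_derive1_comp R expR (fun y : R => - y^-1) t _ _ (is_derive_expR (- t^-1)) Nd.
  have H := is_deriveM H1 H2.
  apply: (near_eq_is_derive (f := (horner p \o (fun y : R => y^-1)) * (expR \o (fun y : R => - y^-1)))).
    by near=> y; rewrite /flat ifT //; near: y; exact: lt_nbhsr.
  apply: is_derive_eq; rewrite /flat t0 !hornerE /= /GRing.scale /=; field; exact: lt0r_neq0.
- rewrite {2}/flat ltNge (ltW t0) /=.
  apply: (near_eq_is_derive (f := cst 0)).
    by near=> y; rewrite /flat ltNge ltW //; near: y; exact: lt_nbhsl.
- rewrite {2}/flat ltxx.
  (* The factor X^2 absorbs the h^-1 of the difference quotient at 0 and leaves one factor h to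
     spare, so that the quotient is O(h). *)
  have [C C0 HC] := horner_expR_bounded (p * 'X^2).
  have B (h : R) : `|h^-1 * flat p h| <= C * `|h|.
    rewrite /flat; case: ifPn => h0; last by rewrite mulr0 normr0 mulr_ge0.
    rewrite (gtr0_norm h0) -ler_pdivrMr //.
    have := HC h^-1; rewrite invr_ge0 => /(_ (ltW h0)).
    apply: le_trans; rewrite hornerM hornerXn.
    have E : `|h^-1| = h^-1 by rewrite gtr0_norm // invr_gt0.
    rewrite -[leLHS](_ : `|h^-1 * (p.[h^-1] * expR (- h^-1)) * h^-1| = _); last by rewrite normrM E.
    by rewrite le_eqVlt; apply/orP; left; apply/eqP; congr `| _ |; ring.
  have L : (fun h : R => h^-1 *: ((flat p \o shift 0) (h *: (1 : R)) - flat p 0)) @ 0^' --> (0 : R).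
    have C1 : 0 < C + 1 by rewrite ltr_wpDl.
    apply/cvgrPdist_le => e e0; near=> h.
    rewrite sub0r normrN /= addr0 [h *: 1]mulr1 {2}/flat ltxx subr0.
    apply: le_trans (B h) _.
    apply: (@le_trans _ _ ((C + 1) * `|h|)); first by rewrite ler_wpM2r // lerDl.
    rewrite mulrC -ler_pdivlMr //; near: h.
    apply: dnbhs0_le; exact: divr_gt0.
  apply: DeriveDef; first by apply/cvg_ex; exists 0.
  exact/cvg_lim.
Unshelve. all: by end_near.
Qed.

Lemma flat_continuous p : continuous (flat p).
Proof.
move=> t; have [fd _] := is_derive_flat p t.
by apply: differentiable_continuous; apply/derivable1_diffP.
Qed.

(** The induction is on k with p arbitrary, because each derivative changes the polynomial. *)
Lemma Ck_flat n k (U : set 'rV[R]_n) f p : open U -> Ck k U f ->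
  Ck k U (fun x => flat p (f x)).
Proof.
have cc (g : 'rV[R]_n -> R) q x : {for x, continuous g} -> {for x, continuous (fun x => flat q (g x))}.
  by move=> cg; apply: continuous_comp => //; exact: flat_continuous.
move=> oU; elim: k f p => [|k IH] f p Cf.
  by split=> // x; rewrite inE => Ux; apply: cc; exact: (Ck_continuous Cf Ux).
apply: Ck_of_derive => //; first by move=> x Ux; apply: cc; exact: (Ck_continuous Cf Ux).
move=> i; have [df fd Cdf] := CkS_derive Cf i.
exists (fun x => flat ((p - p^`()) * 'X^2) (f x) * df x).
  by move=> x Ux; apply: is_derive_comp1; [exact: is_derive_flat|exact: fd].
by apply: CkM => //; apply: IH; exact: CkS.
Qed.

Lemma flat1_gt0 (t : R) : 0 < t -> 0 < flat 1 t.
Proof. by move=> t0; rewrite /flat t0 hornerC mul1r expR_gt0. Qed.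

Lemma flat1_ge0 (t : R) : 0 <= flat 1 t.
Proof. by rewrite /flat; case: ifP => // t0; rewrite hornerC mul1r expR_ge0. Qed.

Lemma flat_le0 p (t : R) : t <= 0 -> flat p t = 0.
Proof. by move=> t0; rewrite /flat ltNge t0. Qed.

End flat_functions.

(** * Smooth functions and sections on a manifold *)

Section smooth_functions.
Context {R : realType} {n : nat} {M : smooth_manifold R n}.
Implicit Types (U V : set M) (f g : M -> R).

(** Points near phi x lie in the open image of the chart, and the continuous inverse chart keeps
    them in U. *)
Lemma chart_image_open (phi : chart R n M) U : open U -> open (phi @` (chart_dom phi `&` U)).
Proof.
move=> oU; rewrite openE => y [x [xd Ux] <-].
have xK : chart_inv phi (phi x) = x by apply: chart_mapK; rewrite inE.
have yI : (phi @` chart_dom phi) (phi x) by exists x.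
have cy := chart_inv_continuous (mem_set yI).
near=> z.
have [w wd wz] : (phi @` chart_dom phi) z.
  by near: z; apply: open_nbhs_nbhs; split => //; exact: chart_img_open.
exists w => //; split=> //.
have <- : chart_inv phi z = w by rewrite -wz; apply: chart_mapK; rewrite inE.
near: z; apply: cy; rewrite xK; exact: open_nbhs_nbhs.
Unshelve. all: by end_near.
Qed.

Lemma smooth_on_eq U f g : open U -> (forall x, U x -> f x = g x) ->
  smooth_on U f -> smooth_on U g.
Proof.
move=> oU fg sf phi aphi k; apply: Ck_eq (sf phi aphi k); first exact: chart_image_open.
move=> y [x [xd Ux] <-] /=; rewrite chart_mapK ?inE //; exact: fg.
Qed.

Lemma smooth_on_subset U V f : V `<=` U -> smooth_on U f -> smooth_on V f.
Proof.
move=> VU sf phi aphi k; apply: Ck_subset (sf phi aphi k).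
by apply: image_subset; exact: setIS.
Qed.

Lemma smooth_onW U f : smooth f -> smooth_on U f.
Proof. exact: smooth_on_subset. Qed.

Lemma smooth_on_local U f :
  (forall x, U x -> exists V, [/\ open V, V x & smooth_on V f]) -> smooth_on U f.
Proof.
move=> H phi aphi k; apply: Ck_local => y [x [xd Ux] <-].
have [V [oV Vx sf]] := H x Ux.
exists (phi @` (chart_dom phi `&` V)); split; [exact: chart_image_open|by exists x|].
exact: sf.
Qed.

Lemma smooth_on_cst U (c : R) : open U -> smooth_on U (fun=> c).
Proof. by move=> oU phi aphi k; apply: Ck_cst; exact: chart_image_open. Qed.

Lemma smooth_onD U f g : open U -> smooth_on U f -> smooth_on U g ->
  smooth_on U (fun x => f x + g x).
Proof.
move=> oU sf sg phi aphi k.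
have H := CkD (chart_image_open (phi := phi) oU) (sf phi aphi k) (sg phi aphi k); exact: H.
Qed.

Lemma smooth_onM U f g : open U -> smooth_on U f -> smooth_on U g ->
  smooth_on U (fun x => f x * g x).
Proof.
move=> oU sf sg phi aphi k.
have H := CkM (chart_image_open (phi := phi) oU) (sf phi aphi k) (sg phi aphi k); exact: H.
Qed.

Lemma smooth_onV U f : open U -> (forall x, U x -> f x != 0) -> smooth_on U f ->
  smooth_on U (fun x => (f x)^-1).
Proof.
move=> oU f0 sf phi aphi k.
have H := CkV (chart_image_open (phi := phi) oU) _ (sf phi aphi k); apply: H.
by move=> y [x [xd Ux] <-] /=; rewrite chart_mapK ?inE //; exact: f0.
Qed.

Lemma smooth_on_flat U f p : open U -> smooth_on U f -> smooth_on U (fun x => flat p (f x)).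
Proof.
by move=> oU sf phi aphi k; have H := Ck_flat p (chart_image_open (phi := phi) oU) (sf phi aphi k); exact: H.
Qed.

Lemma smooth_on_sum U (I : Type) (s : seq I) (P : pred I) (f : I -> M -> R) : open U ->
  (forall i, P i -> smooth_on U (f i)) ->
  smooth_on U (fun x => \sum_(i <- s | P i) f i x).
Proof.
move=> oU sf phi aphi k.
have H := @Ck_sum _ _ k _ I s P (fun i => f i \o chart_inv phi) (chart_image_open (phi := phi) oU).
by apply: H => i Pi; exact: sf.
Qed.

Lemma smooth_onN U f : open U -> smooth_on U f -> smooth_on U (fun x => - f x).
Proof.
move=> oU sf; apply: smooth_on_eq (smooth_onM oU (smooth_on_cst (-1) oU) sf) => // x _.
by rewrite mulN1r.
Qed.

Lemma smooth_onB U f g : open U -> smooth_on U f -> smooth_on U g ->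
  smooth_on U (fun x => f x - g x).
Proof. by move=> oU sf sg; apply: smooth_onD => //; exact: smooth_onN. Qed.

Lemma smooth_on_prod U (I : Type) (s : seq I) (P : pred I) (f : I -> M -> R) : open U ->
  (forall i, P i -> smooth_on U (f i)) ->
  smooth_on U (fun x => \prod_(i <- s | P i) f i x).
Proof.
move=> oU sf; elim: s => [|i s IH].
  by apply: smooth_on_eq (smooth_on_cst 1 oU) => // x _; rewrite big_nil.
case: (boolP (P i)) => Pi.
  by apply: smooth_on_eq (smooth_onM oU (sf i Pi) IH) => // x _; rewrite big_cons Pi.
by apply: smooth_on_eq IH => // x _; rewrite big_cons (negbTE Pi).
Qed.

Lemma smooth_on_chart (phi : chart R n M) (i : 'I_n) : atlas phi ->
  smooth_on (chart_dom phi) (fun x => phi x 0 i).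
Proof. by move=> aphi psi apsi; rewrite /comp; apply: atlas_compat. Qed.

Lemma smooth_on_continuous U f x : smooth_on U f -> U x -> {for x, continuous f}.
Proof.
move=> sf Ux; have [phi aphi xd] := atlas_cover x.
apply: (near_eq_continuous (f := (f \o chart_inv phi) \o phi)).
  by apply: open_near_eq xd => [|y yd /=]; rewrite ?chart_mapK ?inE //; exact: chart_dom_open.
apply: continuous_comp; first by apply: chart_map_continuous; rewrite inE.
by apply: (Ck_continuous (sf phi aphi 0)); exists x.
Qed.

(** The last clause is the form in which the support condition gets used: near each point outside U
    the function is zero, so data given only on U extend by zero after multiplication by t. *)
Lemma cutoff_exists (x : M) U : open U -> U x -> exists t : M -> R,
  [/\ smooth t, (\near x, t x = 1) &
      forall y, U y \/ \near y, t y = 0].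
Proof.
move=> oU Ux; have [phi aphi xd] := atlas_cover x.
have oW := chart_image_open (phi := phi) oU; set W := _ @` _ in oW.
have Wc : W (phi x) by exists x.
have /nbhs_ballP [e /= e0 eW] : nbhs (phi x) W by exact: open_nbhs_nbhs.
pose d := e / 4.
have d0 : 0 < d by rewrite divr_gt0.
have de : 2 * d < e by rewrite /d; lra.
(* The squared Euclidean distance to the centre, in the chart: it is smooth, and it dominates the
   square of the sup norm that defines the balls. *)
pose g (y : M) : R := \sum_(i < n) (phi y 0 i - phi x 0 i) ^+ 2.
pose A y := flat 1 (4 * d ^+ 2 - g y).
pose B y := flat 1 (g y - d ^+ 2).
have AB0 y : 0 < A y + B y.
  have [g1|g1] := ltP (g y) (4 * d ^+ 2).
    by rewrite ltr_pwDl ?flat1_ge0 // flat1_gt0 // subr_gt0.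
  rewrite ltr_wpDl ?flat1_ge0 // flat1_gt0 // subr_gt0; apply: lt_le_trans g1.
  have : 0 < d ^+ 2 by rewrite exprn_gt0.
  lra.
(* A lives where g < 4 d^2 and B where g > d^2. These regions cover everything, so the quotient is
   defined; it is 1 where g <= d^2 and 0 where g >= 4 d^2. *)
pose t y : R := if `[< chart_dom phi y >] then A y * (A y + B y)^-1 else 0.
have od := chart_dom_open phi.
have sg : smooth_on (chart_dom phi) g.
  apply: smooth_on_sum => // i _.
  apply: smooth_on_eq (smooth_onM od (smooth_onB od (smooth_on_chart i aphi) (smooth_on_cst (phi x 0 i) od))
    (smooth_onB od (smooth_on_chart i aphi) (smooth_on_cst (phi x 0 i) od))) => //.
have sA : smooth_on (chart_dom phi) A.
  by apply: smooth_on_flat => //; apply: smooth_onB => //; exact: smooth_on_cst.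
have sB : smooth_on (chart_dom phi) B.
  by apply: smooth_on_flat => //; apply: smooth_onB => //; exact: smooth_on_cst.
have st : smooth_on (chart_dom phi) t.
  apply: (smooth_on_eq (f := fun y => A y * (A y + B y)^-1)) => //.
    by move=> y dy; rewrite /t asboolT.
  apply: smooth_onM => //; apply: smooth_onV => //; last exact: smooth_onD.
  by move=> y _; rewrite gt_eqF.
pose C := [set z : 'rV[R]_n | `|z - phi x| <= 2 * d].
have CW : C `<=` W.
  move=> z /= Cz; apply: eW; rewrite -ball_normE /ball_ /= distrC.
  exact: le_lt_trans de.
have cC : compact C.
  apply: bounded_closed_compact.
    exists (2 * d + `|phi x|); split; first exact: num_real.
    move=> r hr z Cz /=; apply/ltW; apply: le_lt_trans hr.
    rewrite -[z](subrK (phi x)); apply: le_trans (ler_normD _ _) _.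
    by rewrite lerD2r.
  have -> : C = closed_ball (phi x) (2 * d).
    rewrite closed_ballE ?mulr_gt0 //; apply/seteqP; split=> z /=; by rewrite /closed_ball_ /= distrC.
  exact: closed_ball_closed.
pose K := chart_inv phi @` C.
have KdU y : K y -> chart_dom phi y /\ U y.
  by move=> [z /CW [w [wd wU] <-] <-]; rewrite chart_mapK ?inE.
(* Here the Hausdorff axiom enters: the compact K is closed in M, so the chart domain and the
   complement of K form an open cover, and t is smooth on both. *)
have cK : closed K.
  apply: compact_closed; first exact: carrier_hausdorff.
  apply: continuous_compact => //.
  apply: continuous_in_subspaceT => z; rewrite inE => /CW [w [wd wU] <-].
  by apply: chart_inv_continuous; rewrite inE; exists w.
have t0 y : (~` K) y -> t y = 0.
  move=> nK; rewrite /t; case: ifPn => // /asboolP yd.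
  rewrite /A flat_le0 ?mul0r // subr_le0 leNgt; apply/negP => gd; apply: nK.
  exists (phi y); last by rewrite chart_mapK ?inE.
  rewrite /C /= leNgt; apply/negP => nd.
  have : mx_norm (phi y - phi x) != 0 by rewrite gt_eqF // (lt_trans _ nd) // mulr_gt0.
  move=> /mx_norm_neq0 [[i j] /= ij]; move: nd; rewrite /Num.norm /= ij ord1 {i ij} => nd.
  move: gd; apply/negP; rewrite -leNgt /g (bigD1 j) //=.
  have : (2 * d) ^+ 2 < (phi y 0 j - phi x 0 j) ^+ 2.
    rewrite !mxE in nd; rewrite -[ltRHS]real_normK ?num_real //.
    by rewrite ltrXn2r ?nnegrE // mulr_ge0 // ltW.
  rewrite exprMn -natrX => /ltW h; apply: le_trans h _; rewrite lerDl.
  by apply: sumr_ge0 => k _; exact: sqr_ge0.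
have oK : open (~` K) by exact: closed_openC.
exists t; split.
- apply: smooth_on_local => y _.
  have [Ky|nKy] := pselect (K y).
    by exists (chart_dom phi); split=> //; have [] := KdU y Ky.
  exists (~` K); split=> //.
  apply: smooth_on_eq (smooth_on_cst 0 oK) => // z nz.
  by rewrite t0.
- have gx : g x < d ^+ 2.
    by rewrite /g big1 ?exprn_gt0 // => i _; rewrite subrr expr0n.
  have cg := smooth_on_continuous sg xd.
  near=> y.
  have yd : chart_dom phi y by near: y; exact: open_nbhs_nbhs.
  have gy : g y < d ^+ 2 by near: y; apply: (cvgr_lt (g x)) => //; exact: cg.
  have By : B y = 0 by apply: flat_le0; rewrite subr_le0 ltW.
  by rewrite /t asboolT // By addr0 divff //; have := AB0 y; rewrite By addr0 => /lt0r_neq0.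
- move=> y; have [Ky|nKy] := pselect (K y); first by left; have [] := KdU y Ky.
  by right; apply: open_near_eq oK _ _ nKy => z nKz; exact: t0.
Unshelve. all: by end_near.
Qed.

End smooth_functions.

(** * Smooth sections and endomorphisms of a vector bundle *)

Section smooth_sections.
Context {R : realType} {n : nat} {M : smooth_manifold R n} {r : nat}.
Context {E : vbundle M r}.
Implicit Types (U V : set M) (f g : M -> R) (u v w : section E).

Lemma coord_frame (e : local_frame E r) x (a : E x) : frame_dom e x ->
  a = \sum_(i < r) coord (e x) i a *: tnth (e x) i.
Proof.
move=> xe; rewrite {1}(coord_basis (frame_basis xe) (memvf a)).
by apply: eq_bigr => i _; rewrite -tnth_nth.
Qed.

Let oUe U (e : local_frame E r) : open U -> open (U `&` frame_dom e).
Proof. by move=> oU; apply: openI => //; exact: frame_dom_open. Qed.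

Lemma smooth_section_on_eq U u v : open U -> (forall x, U x -> u x = v x) ->
  smooth_section_on U u -> smooth_section_on U v.
Proof.
move=> oU uv su e fe i; apply: smooth_on_eq (su e fe i); first exact: oUe.
by move=> x [Ux _]; rewrite uv.
Qed.

Lemma smooth_section_on_subset U V u : V `<=` U -> smooth_section_on U u -> smooth_section_on V u.
Proof.
by move=> VU su e fe i; apply: smooth_on_subset (su e fe i); exact: setSI.
Qed.

Lemma smooth_section_onW U u : smooth_section u -> smooth_section_on U u.
Proof. exact: smooth_section_on_subset. Qed.

Lemma smooth_section_on_local U u :
  (forall x, U x -> exists V, [/\ open V, V x & smooth_section_on V u]) ->
  smooth_section_on U u.
Proof.
move=> H e fe i; apply: smooth_on_local => x [Ux ex]; have [V [oV Vx sV]] := H x Ux.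
by exists (V `&` frame_dom e); split; [exact: oUe|split|exact: sV].
Qed.

Lemma smooth_section_onD U u v : open U -> smooth_section_on U u -> smooth_section_on U v ->
  smooth_section_on U (u + v).
Proof.
move=> oU su sv e fe i.
apply: smooth_on_eq (smooth_onD (oUe e oU) (su e fe i) (sv e fe i)); first exact: oUe.
by move=> x _; rewrite [(u + v) x]/(u x + v x) linearD.
Qed.

Lemma smooth_section_on_fmul U f u : open U -> smooth_on U f -> smooth_section_on U u ->
  smooth_section_on U (fmul f u).
Proof.
move=> oU sf su e fe i.
have sf' : smooth_on (U `&` frame_dom e) f by apply: smooth_on_subset sf => x [].
apply: smooth_on_eq (smooth_onM (oUe e oU) sf' (su e fe i)); first exact: oUe.
by move=> x _; rewrite /fmul linearZ.
Qed.

Lemma smooth_section_on0 U : open U -> smooth_section_on U (0 : section E).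
Proof.
move=> oU e fe i; apply: smooth_on_eq (smooth_on_cst 0 (oUe e oU)); first exact: oUe.
by move=> x _; rewrite linear0.
Qed.

Lemma smooth_section_on_sum U (I : Type) (s : seq I) (P : pred I) (u : I -> section E) :
  open U -> (forall i, P i -> smooth_section_on U (u i)) ->
  smooth_section_on U (fun x => \sum_(i <- s | P i) u i x).
Proof.
move=> oU su; elim: s => [|i s IH].
  by apply: smooth_section_on_eq (smooth_section_on0 oU) => // x _; rewrite big_nil.
case: (boolP (P i)) => Pi.
  by apply: smooth_section_on_eq (smooth_section_onD oU (su i Pi) IH) => // x _; rewrite big_cons Pi.
by apply: smooth_section_on_eq IH => // x _; rewrite big_cons (negbTE Pi).
Qed.

Lemma smooth_sectionD u v : smooth_section u -> smooth_section v -> smooth_section (u + v).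
Proof. exact: smooth_section_onD openT. Qed.

Lemma smooth_section_fmul f u : smooth f -> smooth_section u -> smooth_section (fmul f u).
Proof. exact: smooth_section_on_fmul openT. Qed.

Lemma smooth_section0 : smooth_section (0 : section E).
Proof. exact: smooth_section_on0 openT. Qed.

Lemma smooth_sectionZ (a : R) u : smooth_section u -> smooth_section (a *: u).
Proof. by apply: smooth_section_fmul; exact: smooth_on_cst openT. Qed.

Lemma smooth_sectionN u : smooth_section u -> smooth_section (- u).
Proof. by rewrite -scaleN1r; exact: smooth_sectionZ. Qed.

Lemma smooth_sectionB u v : smooth_section u -> smooth_section v -> smooth_section (u - v).
Proof. by move=> su sv; apply: smooth_sectionD => //; exact: smooth_sectionN. Qed.

Lemma smooth_section_sum (I : Type) (s : seq I) (P : pred I) (u : I -> section E) :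
  (forall i, P i -> smooth_section (u i)) -> smooth_section (\sum_(i <- s | P i) u i).
Proof.
by move=> su; elim/big_rec: _ => [|i w Pi sw]; [exact: smooth_section0|apply: smooth_sectionD => //; exact: su].
Qed.

Lemma section_sumE (I : Type) (s : seq I) (P : pred I) (u : I -> section E) x :
  (\sum_(i <- s | P i) u i) x = \sum_(i <- s | P i) u i x.
Proof. by elim/big_rec2: _ => // i y1 y2 _ <-. Qed.

Lemma smooth_frame_vec (e : local_frame E r) j : frames e ->
  smooth_section_on (frame_dom e) (fun x => tnth (e x) j).
Proof. by move=> fe e' fe' i; exact: frames_compat. Qed.

(** Near a point of U both factors are smooth; near any other point the product is zero, whatever u
    is there. *)
Lemma smooth_section_cutoff U f u : open U -> smooth f ->
  (forall x, U x \/ \near x, f x = 0) -> smooth_section_on U u ->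
  smooth_section (fmul f u).
Proof.
move=> oU sf f0 su; apply: smooth_section_on_local => x _.
have [Ux|] := f0 x.
  by exists U; split=> //; apply: smooth_section_on_fmul => //; exact: smooth_onW.
rewrite -near_nbhs nbhsE /= => -[V [oV Vx] VU].
exists V; split=> //; apply: smooth_section_on_eq (smooth_section_on0 oV) => // y Vy.
by rewrite /fmul (VU _ Vy) scale0r.
Qed.

Lemma smooth_on_coord U u (e : local_frame E r) i : frames e -> U `<=` frame_dom e ->
  smooth_section_on U u -> smooth_on U (fun x => coord (e x) i (u x)).
Proof.
by move=> fe Ue su; apply: smooth_on_subset (su e fe i) => x Ux; split=> //; exact: Ue.
Qed.

Lemma open_frame U x : open U -> U x -> exists e : local_frame E r, exists V,
  [/\ frames e, open V, V x, V `<=` U & V `<=` frame_dom e].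
Proof.
move=> oU Ux; have [e fe ex] := @frames_cover _ _ _ _ E x.
exists e, (U `&` frame_dom e); by split=> //; [exact: oUe|move=> y []..].
Qed.

Lemma smooth_eapp_on U (A : endo E) u : open U -> smooth_endo A -> smooth_section_on U u ->
  smooth_section_on U (eapp A u).
Proof.
move=> oU sA su; apply: smooth_section_on_local => x Ux.
have [e [V [fe oV Vx VU Ve]]] := open_frame oU Ux.
exists V; split=> //.
pose t i : section E := fmul (fun x => coord (e x) i (u x)) (fun x => A x (tnth (e x) i)).
apply: (smooth_section_on_eq (u := fun x => \sum_(i < r) t i x)) => //.
  move=> y Vy; rewrite /eapp [in RHS](coord_frame (u y) (Ve _ Vy)) linear_sum.
  by apply: eq_bigr => i _; rewrite linearZ.
apply: smooth_section_on_sum => // i _; apply: smooth_section_on_fmul => //.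
  by apply: smooth_on_coord => //; exact: smooth_section_on_subset su.
by apply: smooth_section_on_subset (sA e fe i).
Qed.

Lemma smooth_eapp (A : endo E) u : smooth_endo A -> smooth_section u -> smooth_section (eapp A u).
Proof. exact: smooth_eapp_on openT. Qed.

(** Frame vectors are only local, so they are multiplied by a cutoff to become global sections; near
    the point considered the cutoff is 1 and nothing changes. *)
Lemma smooth_endo_of_eapp (A : endo E) :
  (forall u, smooth_section u -> smooth_section (eapp A u)) -> smooth_endo A.
Proof.
move=> sA e fe j; apply: smooth_section_on_local => x ex.
have [t [st t1 t0]] := cutoff_exists (frame_dom_open e) ex.
have := sA _ (smooth_section_cutoff (frame_dom_open e) st t0 (smooth_frame_vec j fe)).
move: t1; rewrite -near_nbhs nbhsE /= => -[V [oV Vx] VU] su.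
exists V; split=> //.
apply: smooth_section_on_eq (smooth_section_onW V su) => // y Vy.
by rewrite /eapp /fmul linearZ /= (VU _ Vy) scale1r.
Qed.

End smooth_sections.

(** * Courant algebroids *)

Section tangent_calculus.
Context {R : realType} {n : nat} {M : smooth_manifold R n} {x : M}.
Variable v : tangent x.

Lemma derivation0 : v (fun=> 0) = 0.
Proof.
have s0 : smooth (fun _ : M => 0 : R) by exact: smooth_on_cst openT.
have := derivation_linear v 1 s0 s0.
have -> : (fun _ : M => 1 * 0 + 0 : R) = (fun=> 0) by apply/funext => y; rewrite mulr0 addr0.
by rewrite mul1r => /eqP; rewrite -subr_eq subrr eq_sym => /eqP.
Qed.

Lemma derivationD f g : smooth f -> smooth g -> v (fun y => f y + g y) = v f + v g.
Proof.
move=> sf sg; have := derivation_linear v 1 sf sg.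
by rewrite mul1r; under eq_fun do rewrite mul1r.
Qed.

Lemma derivationZ a f : smooth f -> v (fun y => a * f y) = a * v f.
Proof.
move=> sf; have := derivation_linear v a sf (smooth_on_cst 0 openT).
by rewrite derivation0 addr0; under eq_fun do rewrite addr0.
Qed.

Lemma derivationN f : smooth f -> v (fun y => - f y) = - v f.
Proof.
move=> sf; have := derivationZ (-1) sf.
by rewrite mulN1r; under eq_fun do rewrite mulN1r.
Qed.

Lemma derivationB f g : smooth f -> smooth g -> v (fun y => f y - g y) = v f - v g.
Proof.
move=> sf sg; rewrite derivationD ?derivationN //.
exact: smooth_onN openT sg.
Qed.

Lemma derivation_sum (I : Type) (s : seq I) (f : I -> M -> R) :
  (forall i, smooth (f i)) -> v (fun y => \sum_(i <- s) f i y) = \sum_(i <- s) v (f i).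
Proof.
move=> sf; elim: s => [|i s IH].
  by rewrite big_nil -[RHS]derivation0; congr (v _); apply/funext => y; rewrite big_nil.
rewrite big_cons -IH -derivationD //; last by apply: (smooth_on_sum s openT) => j _; exact: sf.
by congr (v _); apply/funext => y; rewrite big_cons.
Qed.

(** Derivations are local: for a cutoff t supported where f = g, the product t (f - g) is
    identically zero, and the Leibniz rule at x turns this into v (f - g) = 0. *)
Lemma derivation_near f g : smooth f -> smooth g -> (\near x, f x = g x) -> v f = v g.
Proof.
move=> sf sg; rewrite -near_nbhs nbhsE /= => -[V [oV Vx] VU].
have [t [st /nbhs_singleton t1 t0]] := cutoff_exists oV Vx.
have sh : smooth (fun y => f y - g y) by exact: smooth_onB openT sf sg.
apply/eqP; rewrite -subr_eq0 -derivationB //.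
have := derivation_leibniz v st sh; rewrite t1 mul1r (VU _ Vx) subrr mulr0 add0r => <-.
rewrite -[X in _ == X]derivation0; apply/eqP; congr (v _); apply/funext => y.
by have [Vy|/nbhs_singleton ->] := t0 y; rewrite ?mul0r // (VU _ Vy) subrr mulr0.
Qed.

End tangent_calculus.

Section courant_basics.
Context {R : realType} {n r : nat} {M : smooth_manifold R n}.
Context {E : courant_algebroid M r}.
Implicit Types (U V : set M) (f g : M -> R) (u v w : section E).

Let EP := courantP E.

Lemma sprod_sym x (a b : E x) : sp a b = sp b a.
Proof. exact: (scalar_sym EP). Qed.

Lemma sprodDl x (a b c : E x) : sp (a + b) c = sp a c + sp b c.
Proof. by have := scalar_linear EP 1 a b c; rewrite scale1r mul1r. Qed.

Lemma sprod0l x (c : E x) : sp 0 c = 0 :> R.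
Proof. by have /eqP := sprodDl 0 0 c; rewrite addr0 -subr_eq subrr eq_sym => /eqP. Qed.

Lemma sprodZl x k (a c : E x) : sp (k *: a) c = k * sp a c.
Proof. by have := scalar_linear EP k a 0 c; rewrite addr0 sprod0l addr0. Qed.

Lemma sprodNl x (a c : E x) : sp (- a) c = - sp a c.
Proof. by rewrite -scaleN1r sprodZl mulN1r. Qed.

Lemma sprodBl x (a b c : E x) : sp (a - b) c = sp a c - sp b c.
Proof. by rewrite sprodDl sprodNl. Qed.

Lemma sprodDr x (a b c : E x) : sp c (a + b) = sp c a + sp c b.
Proof. by rewrite sprod_sym sprodDl !(sprod_sym c). Qed.

Lemma sprod0r x (c : E x) : sp c 0 = 0 :> R.
Proof. by rewrite sprod_sym sprod0l. Qed.

Lemma sprodZr x k (a c : E x) : sp c (k *: a) = k * sp c a.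
Proof. by rewrite sprod_sym sprodZl sprod_sym. Qed.

Lemma sprodNr x (a c : E x) : sp c (- a) = - sp c a.
Proof. by rewrite sprod_sym sprodNl sprod_sym. Qed.

Lemma sprodBr x (a b c : E x) : sp c (a - b) = sp c a - sp c b.
Proof. by rewrite sprodDr sprodNr. Qed.

Lemma sprod_suml x (I : Type) (s : seq I) (P : pred I) (F : I -> E x) c :
  sp (\sum_(i <- s | P i) F i) c = \sum_(i <- s | P i) sp (F i) c.
Proof. by elim/big_rec2: _ => [|i y1 y2 _ <-]; rewrite ?sprod0l ?sprodDl. Qed.

Lemma sprod_sumr x (I : Type) (s : seq I) (P : pred I) (F : I -> E x) c :
  sp c (\sum_(i <- s | P i) F i) = \sum_(i <- s | P i) sp c (F i).
Proof. by rewrite sprod_sym sprod_suml; apply: eq_bigr => i _; rewrite sprod_sym. Qed.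

Lemma sprod_inj x (a b : E x) : (forall c, sp a c = sp b c) -> a = b.
Proof.
move=> ab; apply/eqP; rewrite -subr_eq0; apply/eqP.
by apply: (scalar_nondegenerate EP) => c; rewrite sprodBl ab subrr.
Qed.

Lemma anchorD x (a b : E x) f : smooth f -> anchor (a + b) f = anchor a f + anchor b f.
Proof. by move=> sf; have := anchor_linear EP 1 a b sf; rewrite scale1r mul1r. Qed.

Lemma anchor0 x f : smooth f -> anchor (0 : E x) f = 0.
Proof.
by move=> sf; have /eqP := anchorD (0 : E x) 0 sf; rewrite addr0 -subr_eq subrr eq_sym => /eqP.
Qed.

Lemma anchorZ x k (a : E x) f : smooth f -> anchor (k *: a) f = k * anchor a f.
Proof. by move=> sf; have := anchor_linear EP k a 0 sf; rewrite addr0 anchor0 // addr0. Qed.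

Lemma anchor_sum x (I : Type) (s : seq I) (P : pred I) (F : I -> E x) f : smooth f ->
  anchor (\sum_(i <- s | P i) F i) f = \sum_(i <- s | P i) anchor (F i) f.
Proof. by move=> sf; elim/big_rec2: _ => [|i y1 y2 _ <-]; rewrite ?anchor0 ?anchorD. Qed.

Lemma smooth_on_pairing U u v : open U -> smooth_section_on U u -> smooth_section_on U v ->
  smooth_on U (pairing u v).
Proof.
move=> oU su sv; apply: smooth_on_local => x Ux.
have [e [V [fe oV Vx VU Ve]]] := open_frame (E := E) oU Ux.
exists V; split=> //.
apply: (smooth_on_eq (f := fun y => \sum_(i < r) \sum_(j < r)
  coord (e y) i (u y) * (coord (e y) j (v y) * sp (tnth (e y) i) (tnth (e y) j)))) => //.
  move=> y Vy; rewrite /pairing [in RHS](coord_frame (u y) (Ve _ Vy)) sprod_suml.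
  apply: eq_bigr => i _; rewrite sprodZl [in RHS](coord_frame (v y) (Ve _ Vy)) sprod_sumr.
  by rewrite mulr_sumr; apply: eq_bigr => j _; rewrite sprodZr.
apply: smooth_on_sum => // i _; apply: smooth_on_sum => // j _; apply: smooth_onM => //.
  by apply: smooth_on_coord => //; exact: smooth_section_on_subset su.
apply: smooth_onM => //.
  by apply: smooth_on_coord => //; exact: smooth_section_on_subset sv.
by apply: smooth_on_subset (scalar_smooth EP fe i j).
Qed.

Lemma smooth_pairing u v : smooth_section u -> smooth_section v -> smooth (pairing u v).
Proof. exact: smooth_on_pairing openT. Qed.

Lemma smooth_on_anchor_act U u f : open U -> smooth f -> smooth_section_on U u ->
  smooth_on U (anchor_act u f).
Proof.
move=> oU sf su; apply: smooth_on_local => x Ux.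
have [e [V [fe oV Vx VU Ve]]] := open_frame (E := E) oU Ux.
exists V; split=> //.
apply: (smooth_on_eq (f := fun y => \sum_(i < r)
  coord (e y) i (u y) * anchor (tnth (e y) i : E y) f)) => //.
  move=> y Vy; rewrite /anchor_act [in RHS](coord_frame (u y) (Ve _ Vy)) anchor_sum //.
  by apply: eq_bigr => i _; rewrite anchorZ.
apply: smooth_on_sum => // i _; apply: smooth_onM => //.
  by apply: smooth_on_coord => //; exact: smooth_section_on_subset su.
by apply: smooth_on_subset (anchor_smooth EP fe i sf).
Qed.

Lemma smooth_anchor_act u f : smooth f -> smooth_section u -> smooth (anchor_act u f).
Proof. exact: smooth_on_anchor_act openT. Qed.

(* [d] comes from the inverse of the Gram matrix of [e]. *)
Lemma dual_frame (e : local_frame E r) : frames (v := E) e -> exists d : 'I_r -> section E,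
  (forall i, smooth_section_on (frame_dom e) (d i)) /\
  forall x, frame_dom e x -> forall i (a : E x), coord (e x) i a = sp a (d i x).
Proof.
move=> fe; have oe := frame_dom_open e.
pose G x : 'M[R]_r := \matrix_(i, j) sp (tnth (e x) i) (tnth (e x) j).
have Gu x : frame_dom e x -> G x \in unitmx.
  (* A row c with c G = 0 gives a combination of frame vectors orthogonal to the whole fibre; it
     vanishes by nondegeneracy, and then so does c. *)
  move=> ex; rewrite -row_free_unit -kermx_eq0; apply/eqP/row_matrixP => i.
  rewrite row0; have : row i (kermx (G x)) *m G x = 0 by rewrite -row_mul mulmx_ker row0.
  move: (row i _) => c cG.
  have e0 : \sum_l c 0 l *: tnth (e x) l = 0.
    apply: sprod_inj => b; rewrite sprod0l (coord_frame b ex) sprod_sumr big1 // => j _.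
    rewrite sprodZr sprod_suml; have /rowP/(_ j) := cG; rewrite !mxE => H.
    apply/eqP; rewrite mulf_eq0; apply/orP; right; apply/eqP; rewrite -[RHS]H.
    by apply: eq_bigr => l _; rewrite sprodZl !mxE.
  apply/rowP => l; rewrite mxE.
  have : coord (e x) l (\sum_l c 0 l *: tnth (e x) l) = 0 by rewrite e0 linear0.
  under eq_bigr do rewrite (tnth_nth 0).
  by rewrite coord_sum_free // (basis_free (frame_basis ex)).
have sG i j : smooth_on (frame_dom e) (fun x => G x i j).
  apply: smooth_on_eq (scalar_smooth EP fe i j) => // x _; by rewrite mxE.
have sdet m (A : M -> 'M[R]_m) : (forall i j, smooth_on (frame_dom e) (fun x => A x i j)) ->
    smooth_on (frame_dom e) (fun x => \det (A x)).
  move=> sA; apply: smooth_on_sum => // s _; apply: smooth_onM => //; first exact: smooth_on_cst.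
  by apply: smooth_on_prod.
have sV i j : smooth_on (frame_dom e) (fun x => invmx (G x) i j).
  apply: (smooth_on_eq (f := fun x => (\det (G x))^-1 * cofactor (G x) j i)) => //.
    by move=> x ex; rewrite /invmx Gu // !mxE.
  apply: smooth_onM => //.
    apply: smooth_onV => //; last exact: sdet.
    by move=> x /Gu; rewrite unitmxE unitfE.
  apply: smooth_onM => //; first exact: smooth_on_cst.
  apply: sdet => k l; apply: (smooth_on_eq (f := fun x => G x (lift j k) (lift i l))) => //.
  by move=> x _; rewrite !mxE.
exists (fun i x => \sum_(j < r) fmul (fun y => invmx (G y) j i) (fun y => tnth (e y) j) x).
split=> [i|x ex i a].
  apply: smooth_section_on_sum => // j _; apply: smooth_section_on_fmul => //.
  exact: smooth_frame_vec.
rewrite [in RHS](coord_frame a ex) sprod_suml.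
rewrite (eq_bigr (fun l => coord (e x) l a * (G x *m invmx (G x)) l i)).
  rewrite mulmxV ?Gu // (bigD1 i) //= big1 ?addr0 => [|l li]; first by rewrite mxE eqxx mulr1.
  by rewrite mxE (negbTE li) mulr0.
move=> l _; rewrite sprodZl sprod_sumr mxE; congr (_ * _); apply: eq_bigr => j _.
by rewrite /fmul sprodZr mxE mulrC.
Qed.

End courant_basics.

Lemma big_ord_vanish (V : nmodType) (F : nat -> V) N1 N2 : (N1 <= N2)%N ->
  (forall k, (N1 <= k)%N -> F k = 0) -> \sum_(k < N2) F k = \sum_(k < N1) F k.
Proof.
move=> N12 F0; rewrite -!(big_mkord xpredT) (big_cat_nat (n := N1)) //=.
rewrite [X in _ + X]big_nat [X in _ + X]big1 ?addr0 // => k /andP[k1 _]; exact: F0.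
Qed.

(** * Signed frames without a partition of unity *)

Section signed_frames.
Context {R : realType} {n r : nat} {M : smooth_manifold R n}.
Variable E : courant_algebroid M r.
Implicit Types (U V : set M) (f g : M -> R) (u v w : section E).

(* A locally finite family of global smooth sections [p k j] that decomposes
   every vector [a] as the sum of the [s j <a, p k j> p k j], like an orthonormal
   frame with [s j] in place of the signs. *)
Definition signed_frame (J : finType) (s : J -> R) (p : nat -> J -> section E) :=
  [/\ forall k j, smooth_section (p k j),
      forall x : M, exists N, \near x, forall k j, (N <= k)%N -> p k j x = 0 &
      forall x N, (forall k j, (N <= k)%N -> p k j x = 0) -> forall a : E x,
        a = \sum_(k < N) \sum_j (s j * sp a (p k j x)) *: p k j x].

Let local_datum : Type :=
  ((M -> R) * (M -> R) * ('I_r -> section E) * ('I_r -> section E))%type.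

Let zeta (D : local_datum) : M -> R := D.1.1.2.

(** A frame e and its dual d, both already multiplied by eta and thus global. The relation eta^2 +
    zeta^2 = 1 makes the later sums telescope. *)
Let good_datum (D : local_datum) := let: (eta, zeta, e, d) := D in
  [/\ smooth zeta, forall i, smooth_section (e i) /\ smooth_section (d i),
      forall y, eta y ^+ 2 + zeta y ^+ 2 = 1 &
      forall y (a : E y), (eta y ^+ 2) *: a = \sum_i sp a (d i y) *: e i y].

Let good_datum_exists (x : M) : exists2 D, good_datum D & \near x, zeta D x = 0.
Proof.
have [e fe ex] := @frames_cover _ _ _ _ E x; have oe := frame_dom_open e.
have [d [sd ed]] := dual_frame fe.
have [t [st t1 t0]] := cutoff_exists oe ex.
have t2 y : 0 < 1 + t y * t y by rewrite ltr_wpDr // -expr2 sqr_ge0.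
have smul f g : smooth f -> smooth g -> smooth (fun y => f y * g y) by exact: smooth_onM openT.
have st2 : smooth (fun y => (1 + t y * t y)^-1).
  apply: (smooth_onV openT); first by move=> y _; rewrite gt_eqF.
  by apply: (smooth_onD openT); [exact: smooth_on_cst openT|exact: smul].
(* Rational parametrization of the circle by the cutoff t: eta vanishes with t, zeta vanishes where
   t = 1, and no square root is taken. *)
pose eta y := 2 * t y * (1 + t y * t y)^-1.
pose zet y := (1 - t y * t y) * (1 + t y * t y)^-1.
have seta : smooth eta.
  by apply: (smul) => //; apply: (smul) => //; exact: smooth_on_cst openT.
have eta0 (y : M) : frame_dom e y \/ \near y, eta y = 0.
  have [|t0y] := t0 y; first by left.
  right; near=> z; rewrite /eta (_ : t z = 0) ?mulr0 ?mul0r //; near: z; exact: t0y.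
exists (eta, zet, fun i => fmul eta (fun y => tnth (e y) i), fun i => fmul eta (d i)).
  split.
  - apply: (smul) => //; apply: (smooth_onB openT); first exact: smooth_on_cst openT.
    exact: smul.
  - move=> i; split; apply: (smooth_section_cutoff oe) => //; exact: smooth_frame_vec.
  - by move=> y; rewrite /eta /zet; have := t2 y; move: (t y) => c /lt0r_neq0 c0; field.
  - move=> y a; have [ey|/nbhs_singleton ey] := eta0 y; last first.
      rewrite ey expr0n scale0r big1 // => i _.
      by rewrite /fmul ey !scale0r scaler0.
    rewrite [in LHS](coord_frame a ey) scaler_sumr; apply: eq_bigr => i _.
    by rewrite /fmul sprodZr !scalerA (ed _ ey); congr (_ *: _); ring.
near=> y; rewrite /zeta /= /zet (_ : t y = 1); last by near: y; exact: t1.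
by rewrite mulr1 subrr mul0r.
Unshelve. all: by end_near.
Qed.

(** Filler for indices that code no useful basic open set: eta = 0 adds no term, and zeta = 1 does
    not affect the products. *)
Let good_datum_default : good_datum (fun=> 0, fun=> 1, fun=> 0, fun=> 0).
Proof.
split=> [|i|y|y a]; first exact: smooth_on_cst openT.
- by split; exact: smooth_section0.
- by rewrite expr0n expr1n add0r.
- by rewrite expr0n scale0r big1 // => i _; rewrite scaler0.
Qed.

(** A Lindelöf argument: whenever zeta of some good datum vanishes on a basic open set b, one such
    datum is chosen at the index c b. These b cover M by [good_datum_exists]. *)
Let good_sequence : exists D : nat -> local_datum, (forall k, good_datum (D k)) /\
  forall x : M, exists k, \near x, zeta (D k) x = 0.
Proof.
have [B cB [oB bB]] := carrier_second_countable M.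
have [c cinj] := countable_injP B cB.
pose ok (b : set M) D := good_datum D /\ forall y, b y -> zeta D y = 0.
have /choice [D HD] (k : nat) : exists D : local_datum, good_datum D /\
    forall b, B b -> c b = k -> (exists D', ok b D') -> ok b D.
  have [[b [Bb cb [D' okD]]]|no] := pselect (exists b, [/\ B b, c b = k & exists D', ok b D']).
    exists D'; split; first by case: okD.
    move=> b' Bb' cb' _; suff <- : b = b' by [].
    by apply: cinj; rewrite ?inE // cb.
  eexists; split; first exact: good_datum_default.
  by move=> b Bb cb okb; case: no; exists b.
exists D; split=> [k|x]; first by case: (HD k).
have [D' gD' D0] := good_datum_exists x.
have [b [Bb bx] bD] := bB x _ D0.
exists (c b); have [|_ D0b] := (HD (c b)).2 b Bb erefl.
  by exists D'; split.
have ob := oB _ Bb.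
near=> y; apply: D0b; near: y; exact: open_nbhs_nbhs.
Unshelve. all: by end_near.
Qed.

(** Let m_k be the product of the zeta_l with l < k. The weights (m_k eta_k)^2 have partial sums 1 -
    m_N^2. Each point has a neighbourhood on which some zeta_l vanishes, which kills every m_k with
    k > l: this gives both local finiteness and total weight 1. *)
Lemma signed_frame_exists : exists (J : finType) (s : J -> R) (p : nat -> J -> section E),
  signed_frame s p.
Proof.
have [D [gD D0]] := good_sequence.
pose eta k : M -> R := (D k).1.1.1; pose zet k := zeta (D k).
pose e k := (D k).1.2; pose d k := (D k).2.
have szet k : smooth (zet k) by have := gD k; rewrite /zet /zeta; case: (D k) => [[[? ?] ?] ?] [].
have sed k i : smooth_section (e k i) /\ smooth_section (d k i).
  by have := gD k; rewrite /e /d; case: (D k) => [[[? ?] ?] ?] [].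
have eta_zet k y : eta k y ^+ 2 + zet k y ^+ 2 = 1.
  by have := gD k; rewrite /eta /zet /zeta; case: (D k) => [[[? ?] ?] ?] [].
have ed k y (a : E y) : (eta k y ^+ 2) *: a = \sum_i sp a (d k i y) *: e k i y.
  by have := gD k; rewrite /eta /e /d; case: (D k) => [[[? ?] ?] ?] [].
(* Multiplication by eta^2 is self-adjoint, so e and d may be exchanged. *)
have de k y (a : E y) : (eta k y ^+ 2) *: a = \sum_i sp a (e k i y) *: d k i y.
  apply: sprod_inj => b; rewrite sprodZl -sprodZr ed sprod_sumr sprod_suml.
  by apply: eq_bigr => i _; rewrite sprodZl sprodZr mulrC (sprod_sym b).
pose m k y := \prod_(l < k) zet l y.
have sm k : smooth (m k) by apply: (smooth_on_prod _ openT) => l _; exact: szet.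
have m0 y l k : zet l y = 0 -> (l < k)%N -> m k y = 0.
  by move=> z0 lk; rewrite /m (bigD1 (Ordinal lk)) //= z0 mul0r.
have tele y N : \sum_(k < N) (m k y * eta k y) ^+ 2 = 1 - m N y ^+ 2.
  elim: N => [|N IH]; first by rewrite big_ord0 /m big_ord0 expr1n subrr.
  rewrite big_ord_recr /= IH /m big_ord_recr /= -/(m N y).
  rewrite !exprMn (_ : eta N y ^+ 2 = 1 - zet N y ^+ 2); last by rewrite -(eta_zet N y) addrK.
  ring.
pose sgn (b : bool) : R := if b then 1 else -1.
(* Polarization: (<a,e+d>(e+d) - <a,e-d>(e-d))/4 = (<a,e>d + <a,d>e)/2, and by [ed] and [de] each
   half sums to eta^2 a / 2. *)
pose p k (j : 'I_r * bool) : section E := fmul (m k) (e k j.1 + sgn j.2 *: d k j.1).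
pose s (j : 'I_r * bool) : R := sgn j.2 / 4.
have pE y k (a : E y) :
    \sum_j (s j * sp a (p k j y)) *: p k j y = ((m k y * eta k y) ^+ 2) *: a.
  rewrite -(pair_bigA _ (fun i b => (s (i, b) * sp a (p k (i, b) y)) *: p k (i, b) y)) /=.
  have -> : ((m k y * eta k y) ^+ 2) *: a =
      (m k y ^+ 2 / 2) *: ((eta k y ^+ 2) *: a) + (m k y ^+ 2 / 2) *: ((eta k y ^+ 2) *: a).
    by rewrite -scalerDl scalerA; congr (_ *: _); rewrite exprMn; field.
  rewrite {1}ed de !scaler_sumr -big_split /=; apply: eq_bigr => i _.
  rewrite big_bool /p /s /fmul /sgn /=.
  have pE1 : (e k i + 1 *: d k i) y = e k i y + d k i y by rewrite scale1r.
  have pE2 : (e k i + -1 *: d k i) y = e k i y - d k i y by rewrite scaleN1r.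
  rewrite pE1 pE2 !sprodZr sprodDr sprodBr.
  move: (sp a (e k i y)) (sp a (d k i y)) (e k i y) (d k i y) (m k y) => b1 b2 X Y c.
  rewrite !scalerA scalerBr scalerDr -[- (_ *: Y)]scaleNr addrACA -!scalerDl.
  by congr (_ *: _ + _ *: _); rewrite /GRing.scale /=; field.
exists ('I_r * bool)%type, s, p; split.
- move=> k j; apply: smooth_section_fmul => //; have [se sd] := sed k j.1.
  by apply: smooth_sectionD => //; exact: smooth_sectionZ.
- move=> x; have [l zl] := D0 x; exists l.+1; near=> y => k j lk.
  by rewrite /p /fmul (m0 y l) ?scale0r //; near: y.
- move=> x N pN a; have [l /nbhs_singleton zl] := D0 x.
  (* The given N need not exceed l, so the sum is lengthened by zero terms until m vanishes at its
     upper end. *)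
  pose N' := maxn N l.+1.
  under eq_bigr do rewrite pE.
  rewrite -(@big_ord_vanish _ (fun k => ((m k x * eta k x) ^+ 2) *: a) N N') ?leq_maxl //.
    rewrite -scaler_suml tele (m0 x l) //; last by rewrite leq_max ltnSn orbT.
    by rewrite expr0n subr0 scale1r.
  by move=> k Nk; rewrite -pE big1 // => j _; rewrite pN // scaler0.
Unshelve. all: by end_near.
Qed.

End signed_frames.

(** * Generalized connections *)

Section linear_maps.
Context {R : realType} {n : nat} {M : smooth_manifold R n} {r : nat}.
Variable E : vbundle M r.

(** A connection takes all set-theoretic sections as arguments, whereas its formula is linear on
    fibres only for smooth ones; where linearity fails the endomorphism defaults to 0. *)
Lemma endo_of_linear (g : section E -> forall x, E x -> E x) :
  exists D : section E -> endo E,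
    forall u x, linear (g u x) -> forall b, D u x b = g u x b.
Proof.
exists (fun u x => xget 0 [set phi : 'End(E x) | forall b, phi b = g u x b]) => u x lg.
apply: (@xgetPex _ 0 [set phi : 'End(E x) | forall b, phi b = g u x b]).
pose L := GRing.isLinear.Build R (E x) (E x) _ (g u x) lg.
pose gl : {linear E x -> E x} := HB.pack (g u x) L.
by exists (linfun gl) => b; rewrite lfunE.
Qed.

End linear_maps.

(** * The metric connection of a signed frame *)

Section frame_connection.
Context {R : realType} {n r : nat} {M : smooth_manifold R n}.
Context {E : courant_algebroid M r}.
Implicit Types (f g : M -> R) (u v w : section E).
Context {J : finType} {s : J -> R} {p : nat -> J -> section E}.
Hypothesis fp : signed_frame s p.

Let sp_p k j : smooth_section (p k j).
Proof. by case: fp. Qed.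

Let vanish x N := forall k j, (N <= k)%N -> p k j x = 0.

Lemma signed_frame_bound : exists N : M -> nat, forall x, vanish x (N x).
Proof.
have /choice [N pN] (x : M) : exists N, vanish x N; last by exists N.
by case: fp => _ near_p _; have [N /nbhs_singleton pN] := near_p x; exists N.
Qed.

Lemma frame_sum_bound x N1 N2 (c : nat -> J -> R) : vanish x N1 -> vanish x N2 ->
  \sum_(k < N1) \sum_j c k j *: p k j x = \sum_(k < N2) \sum_j c k j *: p k j x.
Proof.
pose F k := \sum_j c k j *: p k j x.
have F0 N k : vanish x N -> (N <= k)%N -> F k = 0.
  by move=> vN Nk; rewrite /F big1 // => j _; rewrite vN // scaler0.
move=> v1 v2; rewrite -[LHS](@big_ord_vanish _ F N1 (maxn N1 N2)) ?leq_maxl //.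
  by rewrite (@big_ord_vanish _ F N2) ?leq_maxr // => k; exact: F0.
by move=> k; exact: F0.
Qed.

Lemma vector_extension x (a : E x) : exists2 u, smooth_section u & u x = a.
Proof.
have [N pN] := signed_frame_bound; have [_ _ dec] := fp.
exists (\sum_(k < N x) \sum_j (s j * scalar_prod a (p k j x)) *: p k j).
  by apply: smooth_section_sum => k _; apply: smooth_section_sum => j _; exact: smooth_sectionZ.
rewrite [RHS](dec x (N x) (pN x)) section_sumE; apply: eq_bigr => k _.
by rewrite section_sumE.
Qed.

(** If u vanishes at x, cut it off to the neighbourhood where a single N bounds the frame. Then t u
    is a finite sum of global sections p with coefficients t s <u,p> that vanish at x, and phi kills
    it. *)
Lemma eq_of_tensorial x (phi : section E -> R) :
  (forall u v, smooth_section u -> smooth_section v -> phi (u + v) = phi u + phi v) ->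
  (forall f u, smooth f -> smooth_section u -> phi (fmul f u) = f x * phi u) ->
  forall u v, smooth_section u -> smooth_section v -> u x = v x -> phi u = phi v.
Proof.
move=> phiD phiM.
have s1 c : smooth (fun _ : M => c : R) by exact: smooth_on_cst openT.
have phi0 : phi 0 = 0.
  rewrite -[RHS](mul0r (phi 0)) -(phiM (fun=> 0)) //; last exact: smooth_section0.
  by congr phi; apply/functional_extensionality_dep => y; rewrite /fmul scale0r.
have phi_sum (I : Type) (t : seq I) (F : I -> section E) : (forall i, smooth_section (F i)) ->
    phi (\sum_(i <- t) F i) = \sum_(i <- t) phi (F i).
  move=> sF; elim: t => [|i t IH]; first by rewrite !big_nil.
  by rewrite !big_cons phiD ?IH //; apply: smooth_section_sum.
have vanishing u : smooth_section u -> u x = 0 -> phi u = 0.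
  move=> su ux; have [_ near_p dec] := fp.
  have [N] := near_p x; rewrite -near_nbhs nbhsE /= => -[V [oV Vx] VN].
  have [t [st /nbhs_singleton t1 t0]] := cutoff_exists oV Vx.
  have smul f g : smooth f -> smooth g -> smooth (fun y => f y * g y) by exact: smooth_onM openT.
  have sc k j : smooth (fun y => t y * (s j * pairing u (p k j) y)).
    by apply: (smul) => //; apply: (smul) => //; exact: smooth_pairing.
  have -> : phi u = phi (fmul t u) by rewrite phiM // t1 mul1r.
  have -> : fmul t u = \sum_(k < N) \sum_j
      fmul (fun y => t y * (s j * pairing u (p k j) y)) (p k j).
    apply/functional_extensionality_dep => y; rewrite section_sumE /fmul.
    have [Vy|/nbhs_singleton ty] := t0 y.
      rewrite {1}(dec y N (VN y Vy) (u y)) scaler_sumr; apply: eq_bigr => k _.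
      by rewrite section_sumE scaler_sumr; apply: eq_bigr => j _; rewrite scalerA.
    rewrite ty scale0r big1 // => k _; rewrite section_sumE big1 // => j _.
    by rewrite ty mul0r scale0r.
  rewrite phi_sum; last first.
    by move=> k; apply: smooth_section_sum => j _; exact: smooth_section_fmul.
  rewrite big1 // => k _; rewrite phi_sum; last by move=> j; exact: smooth_section_fmul.
  by rewrite big1 // => j _; rewrite phiM // /pairing ux sprod0l !mulr0 mul0r.
move=> u v su sv uv; apply/eqP; rewrite -subr_eq0.
have <- : phi (u - v) = phi u - phi v.
  rewrite phiD //; last exact: smooth_sectionN.
  congr (_ + _); rewrite -mulN1r -(phiM (fun=> -1)) //.
  by congr phi; apply/functional_extensionality_dep => y; rewrite /fmul scaleN1r.
apply/eqP; apply: vanishing; first exact: smooth_sectionB.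
by rewrite [LHS](_ : _ = u x - v x) // uv subrr.
Qed.

(** The bound N may jump from point to point, but near each point it can be replaced by a constant
    without changing the sum. *)
Lemma smooth_frame_sum (c : nat -> J -> M -> R) (N : M -> nat) :
  (forall k j, smooth (c k j)) -> (forall x, vanish x (N x)) ->
  smooth_section (fun x => \sum_(k < N x) \sum_j c k j x *: p k j x).
Proof.
move=> sc pN; apply: smooth_section_on_local => x _; have [_ near_p _] := fp.
have [N0] := near_p x; rewrite -near_nbhs nbhsE /= => -[V [oV Vx] VN].
exists V; split=> //.
apply: (smooth_section_on_eq (u := fun x => \sum_(k < N0) \sum_j fmul (c k j) (p k j) x)) => //.
  by move=> y Vy; apply: (frame_sum_bound (fun k j => c k j y)) => //; exact: VN.
apply: smooth_section_on_sum => // k _; apply: smooth_section_on_sum => // j _.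
by apply: smooth_section_onW; exact: smooth_section_fmul.
Qed.

Lemma frame_connection : exists D : gen_connection E, forall N : M -> nat,
  (forall x, vanish x (N x)) -> forall u v, smooth_section u -> forall x,
  conn_at D v u x =
    \sum_(k < N x) \sum_j (s j * anchor (v x) (pairing u (p k j))) *: p k j x.
Proof.
have [N pN] := signed_frame_bound; have [_ near_p dec] := fp.
pose g u x (b : E x) := \sum_(k < N x) \sum_j (s j * anchor b (pairing u (p k j))) *: p k j x.
have spair u k j : smooth_section u -> smooth (pairing u (p k j)).
  by move=> su; exact: smooth_pairing.
have gl u x : smooth_section u -> linear (g u x).
  move=> su a b c; rewrite /g scaler_sumr -big_split; apply: eq_bigr => k _ /=.
  rewrite scaler_sumr -big_split; apply: eq_bigr => j _ /=.
  rewrite anchorD ?anchorZ; [|exact: spair..].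
  by rewrite scalerA -scalerDl; congr (_ *: _); ring.
have [D DE] := endo_of_linear g.
have DgE u x b : smooth_section u -> D u x b = g u x b.
  by move=> su; apply: DE; exact: gl.
have D_smooth u : smooth_section u -> smooth_endo (D u).
  move=> su; apply: smooth_endo_of_eapp => v sv.
  rewrite (_ : eapp (D u) v = fun x => \sum_(k < N x) \sum_j
      (s j * anchor_act v (pairing u (p k j)) x) *: p k j x).
    apply: (@smooth_frame_sum (fun k j x => s j * anchor_act v (pairing u (p k j)) x)) => // k j.
    apply: smooth_onM openT _ _; first exact: smooth_on_cst openT.
    by apply: smooth_anchor_act => //; exact: spair.
  by apply/functional_extensionality_dep => x; rewrite /eapp DgE.
have D_linear (a : R) u v : smooth_section u -> smooth_section v ->
    forall x, D (a *: u + v) x = a *: D u x + D v x.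
  move=> su sv x; apply/lfunP => b; rewrite add_lfunE scale_lfunE !DgE //; last first.
    by apply: smooth_sectionD => //; exact: smooth_sectionZ.
  rewrite /g scaler_sumr -big_split; apply: eq_bigr => k _ /=.
  rewrite scaler_sumr -big_split; apply: eq_bigr => j _ /=.
  have -> : pairing (a *: u + v) (p k j) = fun y => a * pairing u (p k j) y + pairing v (p k j) y.
    by apply/funext => y; rewrite /pairing sprodDl sprodZl.
  rewrite derivation_linear; [|exact: spair..].
  by rewrite scalerA -scalerDl; congr (_ *: _); ring.
have D_leibniz f u v : smooth f -> smooth_section u -> smooth_section v ->
    eapp (D (fmul f u)) v = fmul (anchor_act v f) u + fmul f (eapp (D u) v).
  move=> sf su sv; apply/functional_extensionality_dep => x.
  rewrite [RHS](_ : _ = anchor (v x) f *: u x + f x *: D u x (v x)) // /eapp.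
  rewrite !DgE //; last exact: smooth_section_fmul.
  rewrite /g [X in _ *: X + _](dec x (N x) (pN x) (u x)) !scaler_sumr -big_split; apply: eq_bigr => k _ /=.
  rewrite !scaler_sumr -big_split; apply: eq_bigr => j _ /=.
  have -> : pairing (fmul f u) (p k j) = fun y => f y * pairing u (p k j) y.
    by apply/funext => y; rewrite /pairing sprodZl.
  rewrite derivation_leibniz //; last exact: spair.
  by rewrite !scalerA -scalerDl /pairing; congr (_ *: _); ring.
have D_metric u v w : smooth_section u -> smooth_section v -> smooth_section w -> forall x,
    anchor_act w (pairing u v) x
      = pairing (eapp (D u) w) v x + pairing u (eapp (D v) w) x.
  move=> su sv sw x; have [N0] := near_p x.
  rewrite -near_nbhs nbhsE /= => -[V [oV Vx] VN].
  have gE (z : section E) : smooth_section z -> D z x (w x) =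
      \sum_(k < N0) \sum_j (s j * anchor (w x) (pairing z (p k j))) *: p k j x.
    move=> sz; rewrite DgE //.
    apply: (frame_sum_bound (fun k j => s j * anchor (w x) (pairing z (p k j)))) => //; exact: VN.
  have smul f h : smooth f -> smooth h -> smooth (fun y => f y * h y) by exact: smooth_onM openT.
  have s1 k j : smooth (fun y => pairing u (p k j) y * pairing v (p k j) y).
    by apply: (smul); exact: spair.
  have s2 k j : smooth (fun y => s j * (pairing u (p k j) y * pairing v (p k j) y)).
    by apply: (smul) => //; exact: smooth_on_cst openT.
  have s3 k : smooth (fun y => \sum_j s j * (pairing u (p k j) y * pairing v (p k j) y)).
    by apply: smooth_on_sum openT _ => j _; exact: s2.
  (* Near x, <u,v> is the finite sum of the s <u,p><v,p>. Locality lets the anchor act on that sum,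
     and the Leibniz rule splits each term into the two sides of metricity. *)
  rewrite /anchor_act (@derivation_near _ _ _ _ _ _ (fun y => \sum_(k < N0) \sum_j
     s j * (pairing u (p k j) y * pairing v (p k j) y))); first last.
  - near=> y; have Vy : V y by near: y; exact: open_nbhs_nbhs.
    rewrite /pairing {1}(dec y N0 (VN y Vy) (u y)) sprod_suml; apply: eq_bigr => k _.
    rewrite sprod_suml; apply: eq_bigr => j _.
    by rewrite sprodZl mulrA (sprod_sym (p k j y)).
  - by apply: smooth_on_sum openT _ => k _; exact: s3.
  - exact: smooth_pairing.
  rewrite derivation_sum; last by move=> k; exact: s3.
  rewrite /pairing /eapp !gE // sprod_suml sprod_sumr -big_split; apply: eq_bigr => k _ /=.
  rewrite derivation_sum; last by move=> j; exact: s2.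
  rewrite sprod_suml sprod_sumr -big_split; apply: eq_bigr => j _ /=.
  rewrite derivationZ; last exact: s1.
  rewrite derivation_leibniz; [|exact: spair..].
  by rewrite sprodZl sprodZr (sprod_sym (p k j x)) /pairing; ring.
exists (GenConnection D_smooth D_linear D_leibniz D_metric) => N' pN' u v su x.
rewrite /conn_at /eapp /= DgE //.
exact: (frame_sum_bound (fun k j => s j * anchor (v x) (pairing u (p k j)))).
Unshelve. all: by end_near.
Qed.

End frame_connection.

(** * Torsion as a skew tensor *)

Section torsion_tensor.
Context {R : realType} {n r : nat} {M : smooth_manifold R n}.
Context {E : courant_algebroid M r}.
Variable D : gen_connection E.
Implicit Types (f g : M -> R) (u v w : section E).

Let EP := courantP E.

Lemma smooth_conn_at u v : smooth_section u -> smooth_section v -> smooth_section (conn_at D v u).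
Proof. by move=> su sv; apply: smooth_eapp => //; exact: conn_smooth. Qed.

Lemma torsionE u v w x : torsion D u v w x =
  pairing (conn_at D u v) w x - pairing (conn_at D v u) w x - pairing (bracket u v) w x
  + pairing (conn_at D w u) v x.
Proof. by rewrite {2 3 4}/pairing -!sprodBl. Qed.

(** The definition of torsion solved for the bracket, used below to eliminate brackets in favour of
    D and its torsion. *)
Lemma bracket_pairing u v w x : pairing (bracket u v) w x =
  pairing (conn_at D u v) w x - pairing (conn_at D v u) w x
  + pairing (conn_at D w u) v x - torsion D u v w x.
Proof.
rewrite torsionE; ring.
Qed.

Lemma smooth_torsion u v w : smooth_section u -> smooth_section v -> smooth_section w ->
  smooth (torsion D u v w).
Proof.
move=> su sv sw; apply: (smooth_onD openT); apply: smooth_pairing => //; last exact: smooth_conn_at.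
apply: smooth_sectionB; last exact: (bracket_smooth EP).
by apply: smooth_sectionB; exact: smooth_conn_at.
Qed.

(** Metricity of D along w matches the axiom for [u,v] + [v,u]. *)
Lemma torsion_sym12 u v w x : smooth_section u -> smooth_section v -> smooth_section w ->
  torsion D u v w x = - torsion D v u w x.
Proof.
move=> su sv sw.
have := bracket_pairing u v w x; have := bracket_pairing v u w x.
have := bracket_symmetrized EP su sv sw x; rewrite (conn_metric D su sv sw).
rewrite {1}/pairing (sprodDl (bracket u v x)) /pairing.
rewrite -/(conn_at D w u) -/(conn_at D w v) (sprod_sym (u x)); lra.
Qed.

(** Metricity of D along u matches the invariance of the scalar product under [u,-]. *)
Lemma torsion_sym23 u v w x : smooth_section u -> smooth_section v -> smooth_section w ->
  torsion D u v w x = - torsion D u w v x.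
Proof.
move=> su sv sw.
have := bracket_pairing u v w x; have := bracket_pairing u w v x.
have := bracket_metric EP su sv sw x; rewrite (conn_metric D sv sw su).
rewrite /pairing -/(conn_at D u v) -/(conn_at D u w).
rewrite (sprod_sym (v x)) (sprod_sym (v x)); lra.
Qed.

Lemma torsionM3 f u v w x : smooth f -> smooth_section u -> smooth_section v -> smooth_section w ->
  torsion D u v (fmul f w) x = f x * torsion D u v w x.
Proof.
move=> sf su sv sw; rewrite !torsionE /pairing /conn_at /eapp /fmul linearZ /= !(sprodZl, sprodZr); ring.
Qed.

Lemma torsionD3 u v w w' x :
  torsion D u v (w + w') x = torsion D u v w x + torsion D u v w' x.
Proof.
rewrite !torsionE /pairing /conn_at /eapp [(w + w') x](_ : _ = w x + w' x) // linearD.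
by rewrite !(sprodDl, sprodDr); ring.
Qed.

Lemma section_through x (a : E x) : exists2 u, smooth_section u & u x = a.
Proof. have [J [s [p fp]]] := signed_frame_exists E; exact: vector_extension fp _ _. Qed.

Let torsion_eq3 u v w w' x : smooth_section u -> smooth_section v ->
  smooth_section w -> smooth_section w' -> w x = w' x ->
  torsion D u v w x = torsion D u v w' x.
Proof.
move=> su sv sw sw' ww'; have [J [s [p fp]]] := signed_frame_exists E.
apply: (eq_of_tensorial fp (x := x) (phi := fun w => torsion D u v w x)) => //.
  by move=> z z' _ _; exact: torsionD3.
by move=> f z sf sz; exact: torsionM3.
Qed.

(** Linearity over functions is visible in the last slot only, so the two skew symmetries bring each
    argument there in turn. *)
Lemma torsion_tensorial u v w u' v' w' x :
  smooth_section u -> smooth_section v -> smooth_section w ->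
  smooth_section u' -> smooth_section v' -> smooth_section w' ->
  u x = u' x -> v x = v' x -> w x = w' x ->
  torsion D u v w x = torsion D u' v' w' x.
Proof.
move=> su sv sw su' sv' sw' uu' vv' ww'.
rewrite (torsion_eq3 su sv sw sw' ww').
rewrite torsion_sym23 // (torsion_eq3 su sw' sv sv' vv') -torsion_sym23 //.
rewrite torsion_sym12 // torsion_sym23 // (torsion_eq3 sv' sw' su su' uu').
by rewrite -torsion_sym23 // -torsion_sym12.
Qed.

(** T is computed on arbitrary smooth extensions of the three vectors. Linearity is stated in one
    slot; skewness transfers it to the others. *)
Lemma torsion_tensor : exists T : forall x : M, E x -> E x -> E x -> R,
  [/\ forall u v w x, smooth_section u -> smooth_section v -> smooth_section w ->
        torsion D u v w x = T x (u x) (v x) (w x),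
      forall x a b c, T x a b c = - T x b a c,
      forall x a b c, T x a b c = - T x a c b &
      forall x k a b c c', T x a b (k *: c + c') = k * T x a b c + T x a b c'].
Proof.
pose ext x (a : E x) : section E := xget 0 [set u | smooth_section u /\ u x = a].
have extP x (a : E x) : smooth_section (ext x a) /\ ext x a x = a.
  apply: (@xgetPex _ 0 [set u | smooth_section u /\ u x = a]).
  by have [u su ux] := section_through a; exists u.
have sext x a : smooth_section (ext x a) := (extP x a).1.
have extE x a : ext x a x = a := (extP x a).2.
exists (fun x a b c => torsion D (ext x a) (ext x b) (ext x c) x); split.
- by move=> u v w x su sv sw; apply: torsion_tensorial.
- by move=> x a b c; exact: torsion_sym12.
- by move=> x a b c; exact: torsion_sym23.
- move=> x k a b c c'; have s1 : smooth (fun _ : M => k) by exact: smooth_on_cst openT.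
  rewrite -(torsionM3 x s1) // -torsionD3.
  have s2 := smooth_section_fmul s1 (sext x c).
  apply: torsion_tensorial => //; first exact: smooth_sectionD.
  by rewrite [RHS](_ : _ = k *: ext x c x + ext x c' x) // !extE.
Qed.

End torsion_tensor.

(** * Adding a tensor to a connection *)

Section connection_shift.
Context {R : realType} {n r : nat} {M : smooth_manifold R n}.
Context {E : courant_algebroid M r}.
Variables (D : gen_connection E) (B : forall x : M, E x -> E x -> E x -> R).
Implicit Types (f g : M -> R) (u v w : section E).
Hypothesis B_linear1 : forall x k a a' b c, B (k *: a + a') b c = k * B a b c + B (x := x) a' b c.
Hypothesis B_linear2 : forall x k a b b' c, B a (k *: b + b') c = k * B a b c + B (x := x) a b' c.
Hypothesis B_skew : forall x a b c, B a b c = - B (x := x) a c b.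
Hypothesis B_smooth : forall u v w, smooth_section u -> smooth_section v -> smooth_section w ->
  smooth (fun x => B (u x) (v x) (w x)).

Let B_linear3 x k (a b c c' : E x) : B a b (k *: c + c') = k * B a b c + B a b c'.
Proof. by rewrite B_skew B_linear2 (B_skew a c) (B_skew a c'); ring. Qed.

Let B0 x (a b : E x) : B a b 0 = 0.
Proof. by have := B_linear3 (-1) a b 0 0; rewrite scaler0 addr0 mulN1r addNr. Qed.

Let BZ x k (a b c : E x) : B a b (k *: c) = k * B a b c.
Proof. by rewrite -[k *: c]addr0 B_linear3 B0 addr0. Qed.

Let B_sum x (a b : E x) (I : Type) (t : seq I) (c : I -> E x) :
  B a b (\sum_(i <- t) c i) = \sum_(i <- t) B a b (c i).
Proof.
elim: t => [|i t IH]; rewrite ?big_nil ?B0 // !big_cons.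
by have := B_linear3 1 a b (c i) (\sum_(j <- t) c j); rewrite scale1r mul1r IH.
Qed.

(** The last index of B is raised by expanding in a signed frame, which also makes the smoothness of
    the result visible. *)
Let raised_tensor : exists op : forall x : M, E x -> E x -> E x,
  (forall x a b c, sp (op x a b) c = B a b c) /\
  forall u v, smooth_section u -> smooth_section v -> smooth_section (fun x => op x (u x) (v x)).
Proof.
have [J [s [p fp]]] := signed_frame_exists E.
have [N pN] := signed_frame_bound fp; have [sp_p _ dec] := fp.
exists (fun x a b => \sum_(k < N x) \sum_j (s j * B a b (p k j x)) *: p k j x); split.
  move=> x a b c; rewrite [in RHS](dec x (N x) (pN x) c).
  rewrite B_sum sprod_suml; apply: eq_bigr => k _; rewrite B_sum sprod_suml.
  by apply: eq_bigr => j _; rewrite sprodZl BZ (sprod_sym c); ring.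
move=> u v su sv.
apply: (@smooth_frame_sum _ _ _ _ _ _ _ _ fp (fun k j x => s j * B (u x) (v x) (p k j x))) => // k j.
apply: smooth_onM openT _ _; first exact: smooth_on_cst openT.
exact: B_smooth.
Qed.

(** Linearity of B in its first slot makes the new operator an endomorphism, linearity in the second
    preserves the Leibniz rule, and skewness in the last two preserves metricity. *)
Lemma connection_shift : exists D' : gen_connection E,
  forall u v x (c : E x), smooth_section u -> smooth_section v ->
  sp (conn_at D' v u x) c = sp (conn_at D v u x) c + B (v x) (u x) c.
Proof.
have [op [opE op_smooth]] := raised_tensor.
have [C CE] := endo_of_linear (fun (u : section E) x (b : E x) => D u x b + op x b (u x)).
have spC u x b c : sp (C u x b) c = sp (D u x b) c + B b (u x) c.
  rewrite CE ?sprodDl ?opE // => k a a'; apply: sprod_inj => d.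
  by rewrite linearP !(sprodDl, sprodZl) !opE B_linear1; ring.
have C_smooth u : smooth_section u -> smooth_endo (C u).
  move=> su; apply: smooth_endo_of_eapp => v sv.
  rewrite (_ : eapp (C u) v = conn_at D v u + (fun x => op x (v x) (u x))).
    by apply: smooth_sectionD; [exact: smooth_conn_at|exact: op_smooth].
  apply/functional_extensionality_dep => x; apply: sprod_inj => c.
  rewrite [RHS](_ : _ = sp (conn_at D v u x + op x (v x) (u x)) c) //.
  by rewrite /eapp spC sprodDl opE.
have C_linear (a : R) u v : smooth_section u -> smooth_section v ->
    forall x, C (a *: u + v) x = a *: C u x + C v x.
  move=> su sv x; apply/lfunP => b; apply: sprod_inj => c.
  rewrite add_lfunE scale_lfunE spC conn_linear // add_lfunE scale_lfunE.
  rewrite (_ : (a *: u + v) x = a *: u x + v x) // !(sprodDl, sprodZl) !spC B_linear2; ring.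
have C_leibniz f u v : smooth f -> smooth_section u -> smooth_section v ->
    eapp (C (fmul f u)) v = fmul (anchor_act v f) u + fmul f (eapp (C u) v).
  move=> sf su sv; apply/functional_extensionality_dep => x; apply: sprod_inj => c.
  rewrite [RHS](_ : _ = sp (anchor_act v f x *: u x + f x *: C u x (v x)) c) // /eapp spC.
  have /(congr1 (fun z : section E => sp (z x) c)) := conn_leibniz D sf su sv.
  rewrite [X in _ = X](_ : _ = sp (anchor_act v f x *: u x + f x *: D u x (v x)) c) //.
  rewrite /eapp => ->; rewrite !(sprodDl, sprodZl) spC.
  have := B_linear2 (f x) (v x) (u x) 0 c.
  rewrite addr0 (B_skew (v x) 0) B0 oppr0 addr0 => ->; ring.
have C_metric u v w : smooth_section u -> smooth_section v -> smooth_section w -> forall x,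
    anchor_act w (pairing u v) x
      = pairing (eapp (C u) w) v x + pairing u (eapp (C v) w) x.
  move=> su sv sw x; rewrite (conn_metric D) // /pairing /eapp (sprod_sym (u x) (C v x _)).
  by rewrite !spC (sprod_sym (u x)) (B_skew (w x) (u x)); ring.
exists (GenConnection C_smooth C_linear C_leibniz C_metric) => u v x c _ _.
exact: spC.
Qed.

End connection_shift.

(** * Generalized almost complex structures *)

Section Bn_structure.
Context {R : realType} {n r : nat} {M : smooth_manifold R n}.
Context {E : courant_algebroid M r}.
Variables (F : endo E) (u0 : section E) (eps : R).
Hypothesis smooth_F : smooth_endo F.
Hypothesis F_skew : forall (x : M) (a b : E x), sp (F x a) b = - sp a (F x b).
Hypothesis eps2 : eps * eps = 1.
Hypothesis smooth_u0 : smooth_section u0.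
Hypothesis norm_u0 : forall x : M, sp (u0 x) (u0 x) = eps.
Hypothesis F2 : forall (x : M) (a : E x), F x (F x a) = - a + (eps * sp a (u0 x)) *: u0 x.

(** The formula for F^2 gives F^2 u0 = 0, and skewness gives <F u0,u0> = 0. Applied to F u0, the
    same formula then reads 0 = - F u0. *)
Lemma F_u0 x : F x (u0 x) = 0.
Proof.
have FF0 : F x (F x (u0 x)) = 0 by rewrite F2 norm_u0 eps2 scale1r addNr.
have Fu0 : sp (F x (u0 x)) (u0 x) = 0.
  by have := F_skew (u0 x) (u0 x); rewrite (sprod_sym (u0 x) (F x _)); lra.
have := F2 (F x (u0 x)); rewrite FF0 linear0 Fu0 mulr0 scale0r addr0 => /esym/eqP.
by rewrite oppr_eq0 => /eqP.
Qed.

Lemma F3 x (a : E x) : F x (F x (F x a)) = - F x a.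
Proof. by rewrite F2 F_skew F_u0 sprod0r oppr0 mulr0 scale0r addr0. Qed.

Lemma sprod_F_u0 x (a : E x) : sp (F x a) (u0 x) = 0.
Proof. by rewrite F_skew F_u0 sprod0r oppr0. Qed.

Let sF u : smooth_section u -> smooth_section (eapp F u).
Proof. exact: smooth_eapp. Qed.

(** The [unit] summand carries [u0] and is nonzero at k = 0 only, so that [u0] enters the family
    exactly once. *)
Let doubled_frame (J : finType) (p : nat -> J -> section E) (k : nat) (j : unit + (J + J)) :
    section E :=
  match j with
  | inl _ => if k is 0 then u0 else 0
  | inr (inl j) => eapp F (p k j)
  | inr (inr j) => eapp F (eapp F (p k j))
  end.

(** The families F p and F^2 p would each reproduce all of -F^2 a, hence the halves; the sign of
    [u0] is its norm. *)
Let doubled_sign (J : finType) (s : J -> R) (j : unit + (J + J)) : R :=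
  match j with inl _ => eps | inr (inl j) | inr (inr j) => s j / 2 end.

(* On the orthogonal complement of [u0], [F] is an isometry, so that [F p] and
   [F (F p)] decompose it just as [p] does. *)
Lemma signed_frame_double (J : finType) (s : J -> R) (p : nat -> J -> section E) :
  signed_frame s p -> signed_frame (doubled_sign s) (doubled_frame p).
Proof.
move=> fp; have [sp_p near_p dec] := fp; split.
- move=> k [_|[j|j]] /=; [|exact: sF|by apply: (sF); exact: sF].
  by case: k => // k; exact: smooth_section0.
- move=> x; have [N pN] := near_p x; exists (maxn N 1); near=> y => k [_|[j|j]] /=.
  + by case: k => //; rewrite geq_max ltn0 andbF.
  + rewrite geq_max /eapp => /andP[Nk _]; rewrite (_ : p k j y = 0) ?linear0 //.
    by move: k j Nk; near: y.
  + rewrite geq_max /eapp => /andP[Nk _]; rewrite (_ : p k j y = 0) ?linear0 //.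
    by move: k j Nk; near: y.
- move=> x N vN a; have [N0 /nbhs_singleton vN0] := near_p x.
  pose G k := \sum_j (doubled_sign s j * sp a (doubled_frame p k j x)) *: doubled_frame p k j x.
  rewrite -[RHS](@big_ord_vanish _ G N (maxn N N0)) ?leq_maxl //; last first.
    by move=> k Nk; rewrite /G big1 // => j _; rewrite vN // scaler0.
  set N1 := maxn N N0.
  have vN1 k j : (N1 <= k)%N -> p k j x = 0.
    by rewrite geq_max => /andP[_]; exact: vN0.
  (* The term of [u0] sits at k = 0, so the range must be nonempty; N = 0 would force u0 x = 0
     against its norm. *)
  have N1_gt0 : (0 < N1)%N.
    rewrite leq_max; apply/orP; left; rewrite lt0n; apply/eqP => N0'.
    have := vN 0%N (inl tt); rewrite N0' => /(_ isT) /= u00.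
    have := norm_u0 x; rewrite u00 sprod0l => e0.
    by have := eps2; rewrite -e0 mul0r => /eqP; rewrite eq_sym oner_eq0.
  have d1 : \sum_(k < N1) \sum_j (s j * sp a (F x (p k j x))) *: F x (p k j x) = - F x (F x a).
    rewrite [in RHS](dec x N1 vN1 (F x a)) linear_sum -sumrN; apply: eq_bigr => k _.
    rewrite linear_sum -sumrN; apply: eq_bigr => j _.
    by rewrite linearZ -scaleNr F_skew mulrN opprK.
  have d2 : \sum_(k < N1) \sum_j (s j * sp a (F x (F x (p k j x)))) *: F x (F x (p k j x))
      = - F x (F x a).
    rewrite -[RHS]F3 [in RHS](dec x N1 vN1 (F x (F x a))) !linear_sum; apply: eq_bigr => k _.
    by rewrite !linear_sum; apply: eq_bigr => j _; rewrite !linearZ !F_skew opprK.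
  have -> : \sum_(k < N1) G k = (eps * sp a (u0 x)) *: u0 x + 2^-1 *: (- F x (F x a)) + 2^-1 *: (- F x (F x a)).
    rewrite -{1}d1 -d2 !scaler_sumr.
    have -> : (eps * sp a (u0 x)) *: u0 x = \sum_(k < N1)
        (eps * sp a (doubled_frame p k (inl tt) x)) *: doubled_frame p k (inl tt) x.
      rewrite (bigD1 (Ordinal N1_gt0)) //= big1 ?addr0 // => -[[|k] hk] //= _.
      by rewrite scaler0.
    rewrite -!big_split; apply: eq_bigr => k _ /=; rewrite /G !big_sumType /=.
    rewrite (big_pred1 tt) => [|[]] //; rewrite addrA !scaler_sumr.
    by congr (_ + _ + _); apply: eq_bigr => j _; rewrite /eapp scalerA; congr (_ *: _); ring.
  rewrite -addrA -scalerDl (_ : 2^-1 + 2^-1 = 1); last by field.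
  by rewrite scale1r F2 opprD opprK addrCA subrr addr0.
Unshelve. all: by end_near.
Qed.

(** F sends F p to F^2 p and F^2 p to - F p, while replacing u by F u changes the coefficients in
    the matching way, so F exchanges the two families of terms. The [u0] term contributes 0 on both
    sides. *)
Lemma invariant_connection : exists D : gen_connection E, preserves D F.
Proof.
have [J [s [p fp]]] := signed_frame_exists E.
have fp2 := signed_frame_double fp.
have [D DE] := frame_connection fp2; have [N vN] := signed_frame_bound fp2.
have sp_p k j : smooth_section (p k j) by case: fp.
exists D => v u sv su; apply/functional_extensionality_dep => x.
rewrite [LHS](_ : _ = conn_at D v (eapp F u) x - F x (conn_at D v u x)) // [RHS](_ : _ = 0 :> E x) //.
apply/eqP; rewrite subr_eq0; apply/eqP.
rewrite !(DE N vN) //; last exact: sF.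
rewrite linear_sum; apply: eq_bigr => k _; rewrite !big_sumType /= linearD.
have H1 j : anchor (v x) (pairing (eapp F u) (eapp F (p k j))) =
    - anchor (v x) (pairing u (eapp F (eapp F (p k j)))).
  rewrite -derivationN; last by apply: smooth_pairing => //; apply: (sF); exact: sF.
  by congr (anchor _ _); apply/funext => y; exact: F_skew.
have H2 j : anchor (v x) (pairing (eapp F u) (eapp F (eapp F (p k j)))) =
    anchor (v x) (pairing u (eapp F (p k j))).
  congr (anchor _ _); apply/funext => y.
  by rewrite /pairing /eapp F_skew F3 sprodNr opprK.
congr (_ + _).
  rewrite !(big_pred1 tt) => [|[]//|[]//] /=; rewrite linearZ /=; case: {+}(k : nat) => [|k'].
    rewrite F_u0 scaler0 (_ : pairing (eapp F u) u0 = fun=> 0); last first.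
      by apply/funext => y; exact: sprod_F_u0.
    by rewrite derivation0 mulr0 scale0r.
  by rewrite (_ : (0 : section E) x = 0) // scaler0 linear0 scaler0.
rewrite linearD !linear_sum addrC; congr (_ + _); apply: eq_bigr => j _.
  by rewrite H2 linearZ.
by rewrite H1 linearZ /= F3 scalerN mulrN scaleNr.
Qed.

(** * Torsion of a connection preserving [F] *)

Section invariant_torsion.
Variable D : gen_connection E.
Hypothesis DF : preserves D F.

Lemma conn_at_F v u x : smooth_section u -> smooth_section v ->
  conn_at D v (eapp F u) x = F x (conn_at D v u x).
Proof.
move=> su sv; apply/eqP; rewrite -subr_eq0; apply/eqP.
exact: (congr1 (fun z : section E => z x) (DF sv su)).
Qed.

(** The hypothesis F^2 u = - u says that u is orthogonal to [u0]; D preserves this since it commutes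
    with F. *)
Lemma conn_at_FF v u x : smooth_section u -> smooth_section v ->
  (forall y, F y (F y (u y)) = - u y) ->
  F x (F x (conn_at D v u x)) = - conn_at D v u x.
Proof.
move=> su sv FFu; rewrite -!conn_at_F //; last exact: sF.
(* The section - u is written as (-2) u + u to fit the shape of [conn_linear]. *)
rewrite (_ : eapp F (eapp F u) = (-2) *: u + u); last first.
  apply/functional_extensionality_dep => y; rewrite [LHS]FFu.
  rewrite [RHS](_ : _ = (-2) *: u y + u y) // -[X in _ + X]scale1r -scalerDl.
  by rewrite (_ : -2 + 1 = -1) ?scaleN1r //; ring.
rewrite /conn_at /eapp conn_linear // add_lfunE scale_lfunE.
by rewrite -[X in _ + X]scale1r -scalerDl (_ : -2 + 1 = -1) ?scaleN1r //; ring.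
Qed.

(* With [z = a - i F a] and [z' = b - i F b], the left-hand side measures the
   failure of [[z, z']] to be a section of [L], up to its component along [u0]. *)
Lemma torsion_obstruction a b w x :
  smooth_section a -> smooth_section b -> smooth_section w ->
  (forall y, F y (F y (a y)) = - a y) -> (forall y, F y (F y (b y)) = - b y) ->
  sp (F x (bracket a b x - bracket (eapp F a) (eapp F b) x)
      - (bracket a (eapp F b) x + bracket (eapp F a) b x)) (w x) =
  torsion D a b (eapp F w) x + torsion D a (eapp F b) w x + torsion D (eapp F a) b w x
  - torsion D (eapp F a) (eapp F b) (eapp F w) x.
Proof.
move=> sa sb sw FFa FFb.
have sFa := sF sa; have sFb := sF sb; have sFw := sF sw.
rewrite sprodBl F_skew sprodBl sprodDl.
have b1 := bracket_pairing D a b (eapp F w) x.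
have b2 := bracket_pairing D (eapp F a) (eapp F b) (eapp F w) x.
have b3 := bracket_pairing D a (eapp F b) w x.
have b4 := bracket_pairing D (eapp F a) b w x.
move: b1 b2 b3 b4; rewrite /pairing !conn_at_F // => b1 b2 b3 b4.
have skew2 (u v c : section E) : smooth_section u -> smooth_section v ->
    (forall y, F y (F y (u y)) = - u y) ->
    sp (F x (conn_at D v u x)) (F x (c x)) = sp (conn_at D v u x) (c x).
  by move=> su sv FFu; rewrite -[LHS]opprK -F_skew conn_at_FF // sprodNl opprK.
have e1 := skew2 b _ w sb sFa FFb; have e2 := skew2 a _ w sa sFb FFa.
have e3 := skew2 a _ b sa sFw FFa.
have e4 := F_skew (conn_at D a b x) (w x); have e5 := F_skew (conn_at D b a x) (w x).
have e6 := F_skew (conn_at D w a x) (b x).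
rewrite /eapp in b1 b2 b3 b4 e1 e2 e3 *; rewrite /eapp.
lra.
Qed.

End invariant_torsion.

(** For z = a + i b the eigenvalue equation reads F a = - b and F b = a, so b is determined by a and
    F^2 a = - a remains. *)
Lemma L_sectionP (z : csection E) : section_of_L F z <->
  exists a, [/\ smooth_section a, forall y, F y (F y (a y)) = - a y & z = (a, - eapp F a)].
Proof.
case: z => z1 z2; split.
  move=> [[/= s1 s2] eig]; exists z1; have e y : F y (z1 y) = - z2 y /\ F y (z2 y) = z1 y.
    by have [] := eig y.
  split=> // [y|]; first by rewrite (e y).1 linearN /= (e y).2.
  congr (_, _); apply/functional_extensionality_dep => y.
  by rewrite [RHS](_ : _ = - F y (z1 y)) // (e y).1 opprK.
move=> [a [sa FFa [-> ->]]]; split; first by split=> //; apply: smooth_sectionN; exact: sF.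
move=> y; rewrite /eigen_i /mul_i /= (_ : (- eapp F a) y = - F y (a y)) // opprK.
by rewrite linearN /= FFa opprK.
Qed.

Lemma bracketN (u v : section E) : smooth_section u -> smooth_section v ->
  bracket (- u) v = - bracket u v /\ bracket u (- v) = - bracket u v.
Proof.
move=> su sv.
have e (z : section E) : - z = (-2) *: z + z.
  by rewrite -[X in _ + X]scale1r -scalerDl (_ : -2 + 1 = -1) ?scaleN1r //; ring.
split.
  by rewrite [in LHS]e (bracket_linearl (courantP E)) // -e.
by rewrite [in LHS]e (bracket_linearr (courantP E)) // -e.
Qed.

Lemma cbracket_L (a b : section E) : smooth_section a -> smooth_section b ->
  cbracket (a, - eapp F a) (b, - eapp F b) =
  (bracket a b - bracket (eapp F a) (eapp F b),
   - (bracket a (eapp F b) + bracket (eapp F a) b)).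
Proof.
move=> sa sb; have sFa := sF sa; have sFb := sF sb.
rewrite /cbracket /= (bracketN sa sFb).2 (bracketN sFa sb).1.
by rewrite (bracketN sFa (smooth_sectionN sFb)).1 (bracketN sFa sFb).2 opprK opprD.
Qed.

Lemma integrable_of_torsion_free (D : gen_connection E) :
  torsion_free D -> preserves D F -> gacs_integrable F.
Proof.
move=> TD DF z w /L_sectionP [a [sa FFa ->]] /L_sectionP [b [sb FFb ->]].
have sFa := sF sa; have sFb := sF sb; have sbr := bracket_smooth (courantP E).
rewrite cbracket_L //; set X := _ - _; set Y := _ + _.
(* The bracket is X - i Y. It lies in L once Y = F X, which is the vanishing of the obstruction, and
   X is orthogonal to [u0]. *)
have FX y : F y (X y) = Y y.
  apply/eqP; rewrite -subr_eq0; apply/eqP/(scalar_nondegenerate (courantP E)) => c.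
  have [u su <-] := section_through c.
  have := torsion_obstruction DF y sa sb su FFa FFb.
  by rewrite !TD ?addr0 ?subrr //; exact: sF.
have perp (u v : section E) (y : M) : smooth_section u -> smooth_section v ->
    (forall t, F t (F t (u t)) = - u t) -> sp (conn_at D v u y) (u0 y) = 0.
  by move=> su sv FFu; rewrite -[conn_at _ _ _ _]opprK -(conn_at_FF DF) // sprodNl sprod_F_u0 oppr0.
(* Derivatives of a, b, F a and F b are orthogonal to [u0]. What remains is <D_u0 a,b> - <D_u0 F a,F
   b>, zero because F is isometric there. *)
have Xu0 y : sp (X y) (u0 y) = 0.
  rewrite [X y](_ : _ = bracket a b y - bracket (eapp F a) (eapp F b) y) // sprodBl.
  have b1 := bracket_pairing D a b u0 y.
  have b2 := bracket_pairing D (eapp F a) (eapp F b) u0 y.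
  move: b1 b2; rewrite !TD // /pairing !(conn_at_F DF) // !sprod_F_u0 !(perp a) // !(perp b) // => -> ->.
  rewrite [sp (F y _) _]F_skew /eapp FFb sprodNr; ring.
apply/L_sectionP; exists X; split.
- by apply: smooth_sectionB; exact: sbr.
- by move=> y; rewrite F2 Xu0 mulr0 scale0r addr0.
- by congr (_, - _); apply/functional_extensionality_dep => y; rewrite -FX.
Qed.

(** Integrability writes the bracket as X - i F X, which makes the left-hand side of
    [torsion_obstruction] zero. Here w is unrestricted; w = [u0] will give the mixed components. *)
Lemma integrable_torsion (D : gen_connection E) a b w x :
  gacs_integrable F -> preserves D F ->
  smooth_section a -> smooth_section b -> smooth_section w ->
  (forall y, F y (F y (a y)) = - a y) -> (forall y, F y (F y (b y)) = - b y) ->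
  torsion D (eapp F a) (eapp F b) (eapp F w) x =
  torsion D a b (eapp F w) x + torsion D a (eapp F b) w x + torsion D (eapp F a) b w x.
Proof.
move=> intF DF sa sb sw FFa FFb.
have La : section_of_L F (a, - eapp F a) by apply/L_sectionP; exists a.
have Lb : section_of_L F (b, - eapp F b) by apply/L_sectionP; exists b.
have := intF _ _ La Lb; rewrite cbracket_L // => /L_sectionP [X [_ _ [XE YE]]].
have := torsion_obstruction DF x sa sb sw FFa FFb.
have -> : bracket a (eapp F b) x + bracket (eapp F a) b x = F x (X x).
  have /(congr1 (fun z : section E => - z x)) := YE.
  rewrite [LHS](_ : _ = - - (bracket a (eapp F b) x + bracket (eapp F a) b x)) // opprK => ->.
  by rewrite [LHS](_ : _ = - - F x (X x)) // opprK.
have -> : bracket a b x - bracket (eapp F a) (eapp F b) x = X x.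
  by rewrite -XE.
rewrite subrr sprod0l; lra.
Qed.

Lemma exists_torsion_free : gacs_integrable F ->
  exists D : gen_connection E, torsion_free D /\ preserves D F.
Proof.
move=> intF; have [D DF] := invariant_connection.
have [T [TE T12 T23 T3]] := torsion_tensor D.
have T2 x k (a b b' c : E x) : T x a (k *: b + b') c = k * T x a b c + T x a b' c.
  by rewrite T23 T3 (T23 x a c b) (T23 x a c b'); ring.
have T1 x k (a a' b c : E x) : T x (k *: a + a') b c = k * T x a b c + T x a' b c.
  by rewrite T12 T2 (T12 x b a) (T12 x b a'); ring.
have T30 x (a b : E x) : T x a b 0 = 0.
  by have := T3 x (-1) a b 0 0; rewrite scaler0 addr0 mulN1r addNr.
have TN3 x (a b c : E x) : T x a b (- c) = - T x a b c.
  by have := T3 x (-1) a b c 0; rewrite addr0 T30 addr0 scaleN1r mulN1r.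
have TN2 x (a b c : E x) : T x a (- b) c = - T x a b c by rewrite T23 TN3 (T23 x a c) opprK.
pose Q x (a : E x) : E x := - F x (F x a).
have QF x (a : E x) : Q x (F x a) = F x a by rewrite /Q F3 opprK.
have FQ x (a : E x) : F x (Q x a) = F x a by rewrite /Q linearN /= F3 opprK.
have QQ x (a : E x) : Q x (Q x a) = Q x a by rewrite {1}/Q FQ.
have QL x k (a b : E x) : Q x (k *: a + b) = k *: Q x a + Q x b.
  by rewrite /Q linearP /= linearP /= opprD scalerN.
have FF x (a : E x) : F x (F x a) = - Q x a by rewrite /Q opprK.
have T_int x (a b c : E x) : T x (F x a) (F x b) (F x c) =
    T x (Q x a) (Q x b) (F x c) + T x (Q x a) (F x b) c + T x (F x a) (Q x b) c.
  (* Applying F^2 to an extension of - a yields a section orthogonal to [u0] everywhere, with value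
     Q a at x. *)
  have [u su ux] := section_through (- a); have [v sv vx] := section_through (- b).
  have [w sw wx] := section_through c.
  pose a' := eapp F (eapp F u); pose b' := eapp F (eapp F v).
  have sFu := sF su; have sFv := sF sv; have sa : smooth_section a' := sF sFu.
  have sb : smooth_section b' := sF sFv.
  have sFa := sF sa; have sFb := sF sb; have sFw := sF sw.
  have FFa' y : F y (F y (a' y)) = - a' y by rewrite /a' /eapp F3.
  have FFb' y : F y (F y (b' y)) = - b' y by rewrite /b' /eapp F3.
  have := integrable_torsion x intF DF sa sb sw FFa' FFb'.
  rewrite !TE // /a' /b' /eapp ux vx wx !linearN /= !F3 !opprK.
  by rewrite -/(Q x a) -/(Q x b).
pose A x (a b c : E x) := - (T x (Q x a) (Q x b) (Q x c) + T x (Q x a) (F x b) (F x c)) / 4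
   - eps * sp a (u0 x) * T x (u0 x) (Q x b) (Q x c).
have A1 x k (a a' b c : E x) : A x (k *: a + a') b c = k * A x a b c + A x a' b c.
  by rewrite /A QL !T1 sprodDl sprodZl; field.
have A2 x k (a b b' c : E x) : A x a (k *: b + b') c = k * A x a b c + A x a b' c.
  by rewrite /A QL linearP !T2; field.
have A23 x (a b c : E x) : A x a b c = - A x a c b.
  by rewrite /A (T23 x (Q x a) (Q x b)) (T23 x (Q x a) (F x b)) (T23 x (u0 x) (Q x b)); field.
have Tc x (a b c : E x) : T x a b c = T x c a b by rewrite T23 T12 opprK.
have T0 x (a b : E x) : T x a a b = 0 by have := T12 x a a b; lra.
(* The part of A without [u0] is F-invariant by its form. For the other part, the torsion identity
   with third argument [u0] gives T(u0,Fb,Qc) = - T(u0,Qb,Fc). *)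
have AF x (a b c : E x) : A x a (F x b) c = - A x a b (F x c).
  have := T_int x (Q x b) (Q x c) (u0 x).
  rewrite F_u0 !T30 !FQ !QQ add0r (Tc x (Q x b) (F x c)) (Tc x (F x b) (Q x c)) => H.
  have H' : T x (u0 x) (F x b) (Q x c) = - T x (u0 x) (Q x b) (F x c) by lra.
  by rewrite /A !QF !FF TN2 TN3 H'; field.
have dec x (a : E x) : a = (eps * sp a (u0 x)) *: u0 x + Q x a.
  by rewrite /Q F2 opprD opprK addrCA subrr addr0.
(* Terms containing [u0] twice vanish by skewness, which leaves four components. *)
have T_dec x (a b c : E x) : T x a b c = T x (Q x a) (Q x b) (Q x c)
    + eps * sp a (u0 x) * T x (u0 x) (Q x b) (Q x c)
    + eps * sp b (u0 x) * T x (u0 x) (Q x c) (Q x a)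
    + eps * sp c (u0 x) * T x (u0 x) (Q x a) (Q x b).
  have {1}-> : T x a b c = T x ((eps * sp a (u0 x)) *: u0 x + Q x a)
      ((eps * sp b (u0 x)) *: u0 x + Q x b) ((eps * sp c (u0 x)) *: u0 x + Q x c).
    by rewrite -!dec.
  rewrite T1 !T2 !T3 !T0 (Tc x (u0 x) (Q x b) (u0 x)) (Tc x (Q x a) (u0 x) (u0 x)) T0.
  rewrite (Tc x (u0 x) (Q x a) (u0 x)) T0 (Tc x (Q x a) (Q x b) (u0 x)).
  by rewrite (Tc x (Q x a) (u0 x)) (Tc x (Q x c)); ring.
(* The torsion identity at F c says that the cyclic sum of T(Qa,Fb,Fc) is T(Qa,Qb,Qc). Three copies
   of the latter plus this one explain the divisor 4; the remaining terms of A give the [u0]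
   components of [T_dec]. *)
have Acyc x (a b c : E x) : A x a b c + A x b c a + A x c a b = - T x a b c.
  have := T_int x a b (F x c); rewrite FF 2!(TN3 x _ _ (Q x c)) => H; rewrite T_dec /A.
  rewrite (Tc x (Q x b) (Q x c) (Q x a)) (Tc x (Q x b) (F x c) (F x a)).
  rewrite -(Tc x (Q x a) (Q x b) (Q x c)) -(Tc x (F x a) (F x b) (Q x c)); lra.
have A_smooth (u v w : section E) : smooth_section u -> smooth_section v -> smooth_section w ->
    smooth (fun x => A x (u x) (v x) (w x)).
  move=> su sv sw; pose Qs u : section E := - eapp F (eapp F u).
  have sQ u' : smooth_section u' -> smooth_section (Qs u').
    by move=> su'; apply: smooth_sectionN; apply: (sF); exact: sF.
  have sT (u1 u2 u3 : section E) : smooth_section u1 -> smooth_section u2 -> smooth_section u3 ->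
      smooth (fun x => T x (u1 x) (u2 x) (u3 x)).
    move=> s1 s2 s3; apply: (smooth_on_eq openT _ (smooth_torsion D s1 s2 s3)) => x _.
    exact: TE.
  have s1 := sT _ _ _ (sQ _ su) (sQ _ sv) (sQ _ sw).
  have s2 := sT _ _ _ (sQ _ su) (sF sv) (sF sw).
  have s3 := sT _ _ _ smooth_u0 (sQ _ sv) (sQ _ sw).
  have sc c : smooth (fun _ : M => c : R) by exact: smooth_on_cst openT.
  have s12 := smooth_onM openT (smooth_onN openT (smooth_onD openT s1 s2)) (sc 4^-1).
  have s4 := smooth_onM openT (smooth_onM openT (sc eps) (smooth_pairing su smooth_u0)) s3.
  exact: (smooth_onB openT s12 s4).
have [D' D'E] := connection_shift D A1 A2 A23 A_smooth.
exists D'; split.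
(* The shift changes the torsion by A(u,v,w) - A(v,u,w) + A(w,u,v), which is the cyclic sum by
   skewness in the last two slots. *)
- move=> u v w su sv sw x; rewrite torsionE /pairing !D'E //.
  have := TE u v w x su sv sw; rewrite torsionE /pairing.
  have := Acyc x (u x) (v x) (w x); rewrite (A23 x (v x) (w x)); lra.
- move=> v u sv su; apply/functional_extensionality_dep => x; apply: sprod_inj => c.
  rewrite [LHS](_ : _ = sp (conn_at D' v (eapp F u) x - F x (conn_at D' v u x)) c) //.
  rewrite [RHS](_ : _ = sp (0 : E x) c) // sprod0l sprodBl F_skew !D'E //; last exact: sF.
  rewrite conn_at_F // F_skew /eapp AF; ring.
Qed.

End Bn_structure.

Theorem theorem7 (R : realType) (n r : nat) (M : smooth_manifold R n)
    (E : courant_algebroid M r) (hE : odd_exact E)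
    (F : endo E) (hF : Bn_gacs F) :
  gacs_integrable F <->
  exists D : gen_connection E, torsion_free D /\ preserves D F.
Proof.
case: hF => sF F_skew _ [u0 [su0 norm_u0 F2]].
have eps2 : (-1) ^+ n * (-1) ^+ n = 1 :> R by rewrite -expr2 sqrr_sign.
split; first exact: (exists_torsion_free sF F_skew eps2 su0 norm_u0 F2).
move=> [D [TD DF]].
exact: (integrable_of_torsion_free sF F_skew eps2 su0 norm_u0 F2 TD DF).
Qed.
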